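(* Let $p$ be an odd prime, $K=\mathbb{Q}(\zeta)$ with $\zeta$ a primitive $p$-th root of unity, $v$ a primitive root modulo $p$, and $\sigma$ the generator of $\mathrm{Gal}(K/\mathbb{Q})$ with $\sigma(\zeta)=\zeta^v$. The element $$\Pi(\sigma)=\sum_{\substack{0\le i\le p-2\\ v_{-i}\text{ even}}}\sigma^i$$ annihilates the non-$p$-part of the ideal class group $\mathbf{C}$ of $K$.
   Context: For $n\in\mathbb{Z}$, $v_n$ denotes the integer with $v_n\equiv v^n\pmod p$ and $1\le v_n\le p-1$. The non-$p$-part of $\mathbf{C}$ is the direct sum of its $h$-Sylow subgroups over primes $h\ne p$. *)

(* Defs.v *)
From HB Require Import structures.
From mathcomp Require Import all_boot all_order all_algebra all_fingroup all_solvable all_field.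
From mathcomp Require Import boolp classical_sets.

Set Implicit Arguments.
Unset Strict Implicit.
Unset Printing Implicit Defensive.

Import Order.TTheory GRing.Theory Num.Theory.
Local Open Scope ring_scope.
Local Open Scope quotient_scope.

Section ClassGroup.
Variable K : fieldExtType rat.
Implicit Types (A B C : set K) (x y a b : K).

Definition ringOfIntegers : set K :=
  [set x | integralOver (intmul (1 : K)) x]%classic.

Lemma integerM a b : ringOfIntegers a -> ringOfIntegers b ->
  ringOfIntegers (a * b).
Proof. exact: (@integral_mul _ _ (intmul (1 : K))). Qed.

Lemma integerD a b : ringOfIntegers a -> ringOfIntegers b ->
  ringOfIntegers (a + b).
Proof. exact: (@integral_add _ _ (intmul (1 : K))). Qed.

Lemma integer0 : ringOfIntegers 0.
Proof. exact: (@integral0 _ _ (intmul (1 : K))). Qed.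

Lemma integer1 : ringOfIntegers 1.
Proof. exact: (@integral1 _ _ (intmul (1 : K))). Qed.

(* Nonzero fractional ideals only. *)
Record is_fracIdeal (I : set K) : Prop := IsFracIdeal {
  fi0 : I 0;
  fiD : forall x y, I x -> I y -> I (x + y);
  fiM : forall a x, ringOfIntegers a -> I x -> I (a * x);
  fi_neq0 : exists2 x, I x & x != 0;
  fi_den : exists d, [/\ ringOfIntegers d, d != 0 &
                         forall x, I x -> ringOfIntegers (d * x)] }.

Record fracIdeal := FracIdeal {
  fi_set :> set K;
  fi_setP : is_fracIdeal fi_set }.

HB.instance Definition _ := gen_eqMixin fracIdeal.
HB.instance Definition _ := gen_choiceMixin fracIdeal.

Lemma fracIdeal_eq (I J : fracIdeal) : fi_set I = fi_set J -> I = J.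
Proof.
case: I J => [I hI] [J hJ] /= eIJ; rewrite -{}eIJ in hJ *.
by rewrite (Prop_irrelevance hI hJ).
Qed.

Definition mulset A B : set K :=
  [set x | exists2 s : seq (K * K),
     (forall u, u \in s -> A u.1 /\ B u.2) & x = \sum_(u <- s) u.1 * u.2]%classic.

Lemma mulset_min A B C :
  C 0 -> (forall x y, C x -> C y -> C (x + y)) ->
  (forall a b, A a -> B b -> C (a * b)) ->
  forall x, mulset A B x -> C x.
Proof.
move=> C0 CD CM x [s sAB ->]; rewrite big_seq.
by apply: big_ind => // u /sAB[Au Bu]; apply: CM.
Qed.

Lemma mulset_mul A B a b : A a -> B b -> mulset A B (a * b).
Proof.
move=> Aa Bb; exists [:: (a, b)]; last by rewrite big_seq1.
by move=> u; rewrite inE => /eqP->.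
Qed.

Lemma mulset0 A B : mulset A B 0.
Proof. by exists [::]; rewrite ?big_nil. Qed.

Lemma mulsetD A B x y : mulset A B x -> mulset A B y -> mulset A B (x + y).
Proof.
move=> [s sAB ->] [t tAB ->]; exists (s ++ t); last by rewrite big_cat.
by move=> u; rewrite mem_cat => /orP[/sAB|/tAB].
Qed.

Lemma mulsetC A B : mulset A B = mulset B A.
Proof.
have sub C D x : mulset C D x -> mulset D C x.
  apply: mulset_min x; [exact: mulset0 | exact: mulsetD |].
  by move=> a b Ca Db; rewrite mulrC; apply: mulset_mul.
by apply/funext => x; apply/propext; split; apply: sub.
Qed.

Lemma mulsetA A B C : mulset A (mulset B C) = mulset (mulset A B) C.
Proof.
have sub D E F x : mulset D (mulset E F) x -> mulset (mulset D E) F x.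
  apply: mulset_min x; [exact: mulset0 | exact: mulsetD |] => a b Da.
  apply: (@mulset_min E F (fun b => mulset (mulset D E) F (a * b))) b.
  - by rewrite mulr0; apply: mulset0.
  - by move=> x y ? ?; rewrite mulrDr; apply: mulsetD.
  by move=> b c Eb Fc; rewrite mulrA; do 2?[apply: mulset_mul].
apply/funext => x; apply/propext; split; first exact: sub.
by rewrite mulsetC (mulsetC A) => /sub; rewrite mulsetC (mulsetC C).
Qed.

Fact mulset_fracIdeal (I J : fracIdeal) : is_fracIdeal (mulset I J).
Proof.
case: I J => [I [I0 ID IM [x Ix x0] [d [Od d0 dI]]]].
case=> [J [J0 JD JM [y Jy y0] [e [Oe e0 eJ]]]] /=; split.
- exact: mulset0.
- exact: mulsetD.
- move=> a z Oa; apply: (@mulset_min I J (fun z => mulset I J (a * z))) z.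
  + by rewrite mulr0; apply: mulset0.
  + by move=> u v ? ?; rewrite mulrDr; apply: mulsetD.
  + by move=> u v Iu Jv; rewrite mulrA; apply: mulset_mul => //; apply: IM.
- by exists (x * y); [apply: mulset_mul | rewrite mulf_neq0].
- exists (d * e); split; [exact: integerM | by rewrite mulf_neq0 |].
  apply: (@mulset_min I J (fun z => ringOfIntegers (d * e * z))).
  + by rewrite mulr0; apply: integer0.
  + by move=> u v ? ?; rewrite mulrDr; apply: integerD.
  + by move=> u v Iu Jv; rewrite mulrACA; apply: integerM; [apply: dI|apply: eJ].
Qed.
Definition mulFI I J := FracIdeal (mulset_fracIdeal I J).

Fact unit_fracIdeal : is_fracIdeal ringOfIntegers.
Proof.
split; [exact: integer0 | exact: integerD | exact: integerM | |].
- by exists 1; [exact: integer1 | exact: oner_neq0].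
- by exists 1; split; [exact: integer1 | exact: oner_neq0 |]
     => x; rewrite mul1r.
Qed.
Definition unitFI := FracIdeal unit_fracIdeal.

Definition scaleset x A : set K := [set x * y | y in A]%classic.

(* Two fractional ideals are equivalent when they differ by a nonzero
   principal fractional ideal. *)
Definition cl_equiv (I J : fracIdeal) : bool :=
  `[< exists2 x, x != 0 & fi_set J = scaleset x I >].

Lemma scalesetA x y A : scaleset x (scaleset y A) = scaleset (x * y) A.
Proof.
apply/funext => z; apply/propext; split.
- by case=> _ [u Au <-] <-; exists u => //; rewrite mulrA.
- by case=> u Au <-; exists (y * u); [exists u | rewrite mulrA].
Qed.

Lemma scaleset1 A : scaleset 1 A = A.
Proof.
apply/funext => z; apply/propext; split=> [[u Au <-]|Az].
  by rewrite mul1r.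
by exists z; rewrite ?mul1r.
Qed.

Lemma mulset_scale x A B : mulset (scaleset x A) B = scaleset x (mulset A B).
Proof.
apply/funext => z; apply/propext; split.
- move: z; apply: mulset_min => [|_ _ [u Mu <-] [w Mw <-]|_ b [u Au <-] Bb].
  + by exists 0; rewrite ?mulr0 //; apply: mulset0.
  + by exists (u + w); rewrite ?mulrDr //; apply: mulsetD.
  + by exists (u * b); rewrite ?mulrA //; apply: mulset_mul.
- case=> w Mw <-; move: w Mw.
  apply: (@mulset_min A B (fun w => mulset (scaleset x A) B (x * w))).
  + by rewrite mulr0; apply: mulset0.
  + by move=> u v ? ?; rewrite mulrDr; apply: mulsetD.
  + by move=> u v Au Bv; rewrite mulrA; apply: mulset_mul => //; exists u.
Qed.

Fact cl_equiv_refl : reflexive cl_equiv.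
Proof.
by move=> I; apply/asboolP; exists 1; rewrite ?oner_neq0 ?scaleset1.
Qed.

Fact cl_equiv_sym : symmetric cl_equiv.
Proof.
have sym I J : cl_equiv I J -> cl_equiv J I.
  move=> /asboolP[x x0 eJ]; apply/asboolP; exists x^-1; rewrite ?invr_eq0 //.
  by rewrite eJ scalesetA mulVf // scaleset1.
by move=> I J; apply/idP/idP; apply: sym.
Qed.

Fact cl_equiv_trans : transitive cl_equiv.
Proof.
move=> J I H /asboolP[x x0 eJ] /asboolP[y y0 eH]; apply/asboolP.
by exists (y * x); rewrite ?mulf_neq0 // eH eJ scalesetA.
Qed.

Canonical cl_equivRel :=
  EquivRel cl_equiv cl_equiv_refl cl_equiv_sym cl_equiv_trans.

(* The ideal class group, written additively.  It is given here the structure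
   of a commutative monoid; that every class has an opposite is the
   invertibility of fractional ideals in a Dedekind domain, and is a property
   of this monoid rather than additional data. *)
Definition idealClass := {eq_quot cl_equiv}.
HB.instance Definition _ := EqQuotient.on idealClass.
HB.instance Definition _ := Choice.on idealClass.

Definition classOf (I : fracIdeal) : idealClass := \pi_idealClass I.

Lemma classOfP (I J : fracIdeal) :
  classOf I = classOf J <-> exists2 x, x != 0 & fi_set J = scaleset x I.
Proof.
split=> [/eqP|eIJ]; first by rewrite eqmodE => /asboolP.
by apply/eqP; rewrite eqmodE; apply/asboolP.
Qed.

Definition class0 : idealClass := classOf unitFI.
Definition classD (c d : idealClass) : idealClass :=
  classOf (mulFI (generic_quotient.repr c) (generic_quotient.repr d)).

Lemma classDE I J : classD (classOf I) (classOf J) = classOf (mulFI I J).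
Proof.
have /classOfP[x x0 eI] : classOf (generic_quotient.repr (classOf I)) = classOf I by apply: reprK.
have /classOfP[y y0 eJ] : classOf (generic_quotient.repr (classOf J)) = classOf J by apply: reprK.
apply/classOfP; exists (x * y); first by rewrite mulf_neq0.
by rewrite /= eI eJ mulset_scale mulsetC mulset_scale mulsetC scalesetA.
Qed.

Lemma classOf_ind (P : idealClass -> Prop) :
  (forall I, P (classOf I)) -> forall c, P c.
Proof. by move=> IP c; rewrite -(reprK c); apply: IP. Qed.

Fact classDA : associative classD.
Proof.
elim/classOf_ind=> I; elim/classOf_ind=> J; elim/classOf_ind=> H.
by rewrite !classDE; congr classOf; apply: fracIdeal_eq; apply: mulsetA.
Qed.

Fact classDC : commutative classD.
Proof.
elim/classOf_ind=> I; elim/classOf_ind=> J.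
by rewrite !classDE; congr classOf; apply: fracIdeal_eq; apply: mulsetC.
Qed.

Fact class0D : left_id class0 classD.
Proof.
elim/classOf_ind=> I; rewrite classDE; congr classOf; apply: fracIdeal_eq.
have [I0 ID IM _ _] := fi_setP I.
apply/funext=> x; apply/propext; split; first exact: mulset_min.
by move=> Ix; rewrite -[x]mul1r; apply: mulset_mul => //; apply: integer1.
Qed.

HB.instance Definition _ := GRing.isNmodule.Build idealClass
  classDA classDC class0D.

Lemma classOfM I J : classOf (mulFI I J) = classOf I + classOf J.
Proof. exact/esym/classDE. Qed.

Lemma classOf_eq0 (I : fracIdeal) :
  classOf I = 0 <-> exists2 x, x != 0 & fi_set I = scaleset x ringOfIntegers.
Proof.
by split=> [/esym/classOfP|eI]; last by apply/esym/classOfP.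
Qed.

Lemma integer_aut (f : 'AEnd(K)) x : ringOfIntegers x -> ringOfIntegers (f x).
Proof.
move=> Ox; have := integral_rmorph f Ox; congr integralOver.
by apply/funext => n /=; rewrite rmorph_int.
Qed.

(* An algebra endomorphism of K is an automorphism, so f @` I is again a
   fractional ideal. *)
Fact image_fracIdeal (f : 'AEnd(K)) (I : fracIdeal) :
  is_fracIdeal (f @` I)%classic.
Proof.
have [I0 ID IM [x Ix x0] [d [Od d0 dI]]] := fi_setP I.
have fK : cancel (f^-1)%AF f by apply: lker0_lfunVK; apply: AEnd_lker0.
have f_neq0 y : y != 0 -> f y != 0 by rewrite fmorph_eq0.
split.
- by exists 0; rewrite ?rmorph0.
- by move=> _ _ [y Iy <-] [z Iz <-]; exists (y + z); rewrite ?rmorphD //; apply: ID.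
- move=> a _ Oa [y Iy <-]; exists ((f^-1)%AF a * y); last by rewrite rmorphM /= fK.
  by apply: IM => //; apply: integer_aut.
- by exists (f x); [exists x | apply: f_neq0].
- exists (f d); split; [exact: integer_aut | exact: f_neq0 |].
  by move=> _ [y Iy <-]; rewrite -rmorphM; apply: integer_aut; apply: dI.
Qed.
Definition imageFI f I := FracIdeal (image_fracIdeal f I).

Definition classAut (f : 'AEnd(K)) (c : idealClass) : idealClass :=
  classOf (imageFI f (generic_quotient.repr c)).

Lemma classAutE f I : classAut f (classOf I) = classOf (imageFI f I).
Proof.
have /classOfP[x x0 eI] : classOf (generic_quotient.repr (classOf I)) = classOf I
  by apply: reprK.
apply/classOfP; exists (f x); rewrite ?fmorph_eq0 //= eI.
apply/funext => z; apply/propext; split.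
- by case=> _ [y Jy <-] <-; exists (f y); [exists y | rewrite rmorphM].
- by case=> _ [y Jy <-] <-; exists (x * y); [exists y | rewrite rmorphM].
Qed.
End ClassGroup.

Section NonPPart.
Variable V : nmodType.
Implicit Types (S T : set V) (h p : nat).

Record is_subgroup S : Prop := IsSubgroup {
  sg0 : S 0;
  sgD : forall x y, S x -> S y -> S (x + y);
  sgN : forall x, S x -> exists2 y, S y & x + y = 0 }.

Definition is_hgroup h S : Prop :=
  is_subgroup S /\ forall x, S x -> exists k, x *+ (h ^ k) = 0.

Definition is_Sylow h S : Prop :=
  is_hgroup h S /\ forall T, is_hgroup h T -> (S `<=` T)%classic -> T = S.

(* The family x has finite support s; V is commutative, so the sum of its
   Sylow subgroups is direct. *)
Definition nonp_part p : set V :=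
  [set c | exists (s : seq nat) (x : nat -> V),
     [/\ uniq s,
         forall h, h \in s ->
           [/\ prime h, h != p & exists2 S, is_Sylow h S & S (x h)]
       & c = \sum_(h <- s) x h]]%classic.
End NonPPart.

(* The representative of v ^ n mod p among 0, ..., p - 1, for n : int; it is
   nonzero when p is a prime not dividing v. *)
Definition vres (p : nat) (v n : int) : nat :=
  ((v%:~R : 'F_p) ^ n : 'F_p)%R.

Lemma vres_bounds (p : nat) (v n : int) : prime p ->
  (v%:~R : 'F_p) != 0 -> (1 <= vres p v n <= p.-1)%N.
Proof.
move=> pr_p v0; have ltp : (vres p v n < p)%N.
  by rewrite -[X in (_ < X)%N](Fp_cast pr_p) ltn_ord.
apply/andP; split; last by rewrite -ltnS prednK ?prime_gt0.
by rewrite lt0n; have := expfz_neq0 n v0; rewrite -val_eqE.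
Qed.

Lemma vres_cong (p : nat) (v n : int) :
  (vres p v n)%:R = (v%:~R : 'F_p) ^ n.
Proof. exact: natr_Zp. Qed.

(* The action of Pi(sigma) on ideal classes. *)
Definition PiAct (K : splittingFieldType rat) (p : nat) (v : int)
    (sigma : gal_of {:K}) (c : idealClass K) : idealClass K :=
  \sum_(0 <= i < p.-1 | ~~ odd (vres p v (- i%:Z)))
     classAut (sigma ^+ i)%g c.

(* Main.v *)
Require Import Defs.
From HB Require Import structures.
From mathcomp Require Import all_boot all_order all_algebra all_fingroup all_solvable all_field.
From mathcomp Require Import boolp classical_sets.
From mathcomp Require Import ring zify.

(** Stickelberger's relation for the multiplier 2.  Let l be a rational prime
    congruent to 1 modulo p, let t have order p modulo l, and let
    L = (l, zeta - t), a prime above l with residue field F_l.  A character psi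
    of F_l of order p is fixed by psi(x) = zeta^i when x^((l-1)/p) = t^(2i).
    Its Jacobi sum g, the sum of psi(x) psi(1-x) over x in F_l, has absolute
    value sqrt l, in the form g g' = l with g' the Jacobi sum of the inverse
    character.  Modulo the conjugate f(L) one has zeta = t^w, where w is the
    exponent with zeta = f(zeta)^w and 0 < w < p; if w is even then psi(x) is
    congruent to x^((l-1)w/2p), so g is congruent to a sum over F_l of the values
    of a polynomial of degree less than l-1 and vanishes.  If w is odd the same
    computation with p - w shows that g' vanishes.  The conjugates of L are
    pairwise coprime with product (l) = (g)(g'), so g generates exactly the
    product of the f(L) with w even.  For f = sigma^i the exponent w is
    v_{-i}, so this product is Pi(sigma) L: the class of L is annihilated
    ([stickelberger_principal]).

    It remains to see that such primes L generate the classes in question.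
    Unique factorization into primes is avoided altogether: an integral ideal J
    coprime to p and to each of its conjugates f(J), f != 1, is called split.
    For such a J the trace shows that every algebraic integer is congruent to a
    rational integer modulo J ([split_residue]), and if l is a prime dividing the
    least positive integer of J, then J is contained in L = (l, zeta - t) for a
    suitable t and is the product of L and a split ideal containing a smaller
    positive integer.  Hence split ideals are products of primes L
    ([split_ideal_ind]).

    Finally each invertible class contains a split ideal
    ([split_representative]).  If A B = (1) with A integral, the ideals alpha B
    with alpha in A are integral and lie in the class of B.  Take
    alpha = x + n with n a rational integer.  As alpha - f(alpha) = x - f(x)
    does not depend on n, alpha B and its conjugates can only fail to be coprime
    at primes dividing the norms of the x - f(x); these are finitely many, and n
    is chosen so that the norm of alpha avoids them.  Let N be a positive integer
    of A.  At the primes dividing N there is no such freedom, since n has to be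
    a multiple of N for alpha to stay in A, and x is chosen there as a local
    generator of A ([local_generator]); at the other primes below p there may be
    too few residues for n, and x is chosen congruent to zeta, whose differences
    zeta - f(zeta) only involve p.  A class of the non-p-part is a sum of
    elements of Sylow subgroups, hence invertible, and the theorem follows. *)

Set Implicit Arguments.
Unset Strict Implicit.
Unset Printing Implicit Defensive.
Import Order.TTheory GRing.Theory Num.Theory.
Local Open Scope ring_scope.

(** * Power sums and Jacobi sums over a finite field *)

Section FiniteField.
Variable F : finFieldType.

Lemma exists_expf_neq1 j : (0 < j < #|F|.-1)%N ->
  exists2 g : F, g != 0 & g ^+ j != 1.
Proof.
move=> /andP[j0 jF]; apply: contrapT => no_g.
pose P : {poly F} := 'X^j - 1.
have szP : size P = j.+1 by apply: size_XnsubC.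
have rP : all (root P) (enum (predC1 (0 : F))).
  apply/allP => x; rewrite mem_enum inE => x0; rewrite /root /P !hornerE.
  by rewrite subr_eq0; apply/negPn/negP => x1; apply: no_g; exists x.
have := @max_poly_roots _ P (enum (predC1 (0 : F))).
rewrite -size_poly_gt0 szP => /(_ isT rP (enum_uniq _)); rewrite -cardE cardC1.
by rewrite ltnS leqNgt jF.
Qed.

(** For positive j the sum is multiplied by g^j when x is replaced by g x; for
    j = 0 it is the difference between the sums of 1 + x and of x. *)
Lemma sum_expf_eq0 j : (j < #|F|.-1)%N -> \sum_(x : F) x ^+ j = 0.
Proof.
case: j => [|j] jF.
  have e : \sum_(x : F) x = \sum_x (1 + x) by exact: (reindex_inj (addrI 1)).
  move: e; rewrite big_split /= => /eqP; rewrite eq_sym -subr_eq0 addrK => /eqP.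
  by move=> e; rewrite -[RHS]e; apply: eq_bigr => x _; rewrite expr0.
have [g g0 g1] := exists_expf_neq1 (j := j.+1) jF.
have : g ^+ j.+1 * \sum_(x : F) x ^+ j.+1 = \sum_(x : F) x ^+ j.+1.
  rewrite mulr_sumr [RHS](reindex_inj (mulfI g0)) /=.
  by apply: eq_bigr => x _; rewrite exprMn.
move/eqP; rewrite -subr_eq0 -{2}[\sum_x _]mul1r -mulrBl mulf_eq0 subr_eq0.
by rewrite (negPf g1) => /eqP.
Qed.

Lemma sum_horner_eq0 (P : {poly F}) : (size P <= #|F|.-1)%N ->
  \sum_(x : F) P.[x] = 0.
Proof.
move=> szP; under eq_bigr do rewrite horner_coef.
rewrite exchange_big big1 //= => i _; rewrite -mulr_sumr sum_expf_eq0 ?mulr0 //.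
exact: leq_trans szP.
Qed.

Lemma sum_expf_beta a b : (a + b < #|F|.-1)%N ->
  \sum_(x : F) x ^+ a * (1 - x) ^+ b = 0.
Proof.
move=> abF; have := @sum_horner_eq0 ('X^a * (1 - 'X) ^+ b).
under eq_bigr do rewrite !hornerE; apply; apply: leq_trans abF.
have sz1 : size (1 - 'X : {poly F}) = 2 by rewrite -opprB size_polyN size_XsubC.
have := size_poly_exp_leq (1 - 'X : {poly F}) b; rewrite sz1 mul1n => szb.
rewrite (leq_trans (size_polyMleq _ _)) // size_polyXn addSn /=.
by rewrite -addnS leq_add2l.
Qed.

Variable R : fieldType.
Variable psi : F -> R.
Hypotheses (psi0 : psi 0 = 0) (psi1 : psi 1 = 1) (psiM : {morph psi : x y / x * y}).

Lemma sum_char_eq0 g : g != 0 -> psi g != 1 -> \sum_x psi x = 0.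
Proof.
move=> g0 g1; have : psi g * \sum_x psi x = \sum_x psi x.
  rewrite mulr_sumr [RHS](reindex_inj (mulfI g0)) /=.
  by apply: eq_bigr => x _; rewrite psiM.
move/eqP; rewrite -subr_eq0 -{2}[\sum_x _]mul1r -mulrBl mulf_eq0 subr_eq0.
by rewrite (negPf g1) => /eqP.
Qed.

Definition jacobi_sum (chi : F -> R) := \sum_x chi x * chi (1 - x).

Hypotheses (sum_psi : \sum_x psi x = 0) (sum_psi2 : \sum_x psi x ^+ 2 = 0).

(** The substitution y |-> (1 - y u) / (1 - y) maps F minus 1 bijectively onto F
    minus u, and the sum of psi over F is zero; the value at y = 0 is psi 1. *)
Lemma sum_char_moebius u : u != 0 -> u != 1 ->
  \sum_(y | (y != 0) && (y != 1)) psi ((1 - y * u) / (1 - y)) = - psi u - 1.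
Proof.
move=> u0 u1.
have bij : \sum_(w | w != u) psi w = \sum_(y | y != 1) psi ((1 - y * u) / (1 - y)).
  rewrite (reindex_onto (fun y => (1 - y * u) / (1 - y)) (fun w => (w - 1) / (w - u))) /=.
    apply: eq_bigl => y; have [->|y1] := eqVneq y 1.
      rewrite subrr invr0 mulr0 sub0r sub0r invrN mulrNN mul1r.
      by apply/negbTE; rewrite invr_eq1 negb_and u1 orbT.
    have y1' : 1 - y != 0 by rewrite subr_eq0 eq_sym.
    have eu : (1 - y * u) / (1 - y) - u = (1 - u) / (1 - y) by field.
    have e1 : (1 - y * u) / (1 - y) - 1 = y * ((1 - u) / (1 - y)) by field.
    have nz : (1 - u) / (1 - y) != 0.
      by rewrite mulf_neq0 ?invr_eq0 // subr_eq0 eq_sym.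
    by rewrite -subr_eq0 eu nz e1 mulfK ?eqxx.
  move=> w wu; have wu' : w - u != 0 by rewrite subr_eq0.
  have u1' : 1 - u != 0 by rewrite subr_eq0 eq_sym.
  by field; rewrite wu' /=; have -> : w - u - (w - 1) = 1 - u by ring.
have sum_neq : \sum_(w | w != u) psi w = - psi u.
  by have := sum_psi; rewrite (bigD1 u) //= addrC => /eqP; rewrite addr_eq0 => /eqP.
rewrite sum_neq (bigD1 0) ?(eq_sym 0) ?oner_neq0 //= in bij.
rewrite bij mul0r !subr0 divr1 psi1 addrAC subrr add0r.
by apply: eq_bigl => y; rewrite andbC.
Qed.

(** In the double sum over x and y put x = y u.  The terms with u = 1 contribute
    #|F| - 2, and by [sum_char_moebius] those with another u contribute
    - psi(u)^2 - psi(u), which add up to 2 because psi and psi^2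
    sum to zero. *)
Lemma jacobi_sum_norm :
  jacobi_sum psi * jacobi_sum (fun x => psi x^-1) = #|F|%:R.
Proof.
rewrite /jacobi_sum mulr_sumr.
have e1 y : (y != 0) && (y != 1) ->
  (\sum_x psi x * psi (1 - x)) * (psi y^-1 * psi (1 - y)^-1) =
  \sum_u psi u * psi ((1 - y * u) / (1 - y)).
  move=> /andP[y0 y1]; rewrite (reindex_inj (mulfI y0)) mulr_suml /=.
  apply: eq_bigr => u _; rewrite -!psiM; congr psi.
  have y1' : 1 - y != 0 by rewrite subr_eq0 eq_sym.
  by field; rewrite ?y0 ?y1'.
rewrite (bigID (fun y => (y != 0) && (y != 1))) /= [X in _ + X]big1 ?addr0; last first.
  move=> y; rewrite negb_and !negbK => /orP[]/eqP->.
    by rewrite invr0 psi0 mul0r mulr0.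
  by rewrite subrr invr0 psi0 !mulr0.
rewrite (eq_bigr _ e1) exchange_big /=; under eq_bigr do rewrite -mulr_sumr.
rewrite (bigD1 0) //= psi0 mul0r add0r (bigD1 1) ?oner_neq0 //=.
rewrite psi1 mul1r (eq_bigr (fun=> 1)) => [|y /andP[y0 y1]]; last first.
  by rewrite mulr1 divff ?psi1 // subr_eq0 eq_sym.
rewrite [X in _ + X](eq_bigr (fun u => - (psi u ^+ 2) - psi u)); last first.
  by move=> u /andP[u0 u1]; rewrite sum_char_moebius // mulrBr mulrN mulr1.
rewrite big_split /= !sumrN.
have drop (G : F -> R) : G 0 = 0 -> G 1 = 1 -> \sum_x G x = 0 ->
    \sum_(x | (x != 0) && (x != 1)) G x = -1.
  move=> G0 G1; rewrite (bigD1 0) //= G0 add0r (bigD1 1) ?oner_neq0 //= G1.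
  by move/eqP; rewrite addrC addr_eq0 => /eqP.
rewrite (drop psi) // (drop (fun u => psi u ^+ 2)) ?psi0 ?psi1 ?expr0n ?expr1n ?opprK //.
have -> : #|F|%:R = \sum_(y : F) 1 :> R by rewrite sumr_const.
by rewrite [RHS](bigD1 0) //= [X in _ = _ + X](bigD1 1) ?oner_neq0 //=; ring.
Qed.
End FiniteField.

(** * Algebraic integers and congruences modulo a rational integer *)

Section Integers.
Variable K : fieldExtType rat.
Local Notation O := (@ringOfIntegers K).

Lemma integerN x : O x -> O (- x).
Proof. exact: (@integral_opp _ _ (intmul (1 : K))). Qed.

Lemma integerB x y : O x -> O y -> O (x - y).
Proof. by move=> Ox Oy; apply: integerD => //; apply: integerN. Qed.

Lemma integer_int (m : int) : O m%:~R.
Proof. exact: (@integral_id _ _ (intmul (1 : K))). Qed.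

Lemma integer_nat n : O n%:R.
Proof. exact: (integer_int n). Qed.

Lemma integer_sum I (r : seq I) (P : pred I) (F : I -> K) :
  (forall i, P i -> O (F i)) -> O (\sum_(i <- r | P i) F i).
Proof. by move=> OF; apply: big_ind => //; [apply: integer0 | apply: integerD]. Qed.

Lemma integer_prod I (r : seq I) (P : pred I) (F : I -> K) :
  (forall i, P i -> O (F i)) -> O (\prod_(i <- r | P i) F i).
Proof. by move=> OF; apply: big_ind => //; [apply: integer1 | apply: integerM]. Qed.

Lemma integerX n x : O x -> O (x ^+ n).
Proof.
by move=> Ox; elim: n => [|n IH]; rewrite ?expr0 ?exprS;
  [apply: integer1 | apply: integerM].
Qed.

Lemma in_alg_int (m : int) : (m%:~R : rat)%:A = m%:~R :> K.
Proof. exact: (rmorph_int (in_alg K)). Qed.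

Lemma field_intr_eq0 (m : int) : (m%:~R == 0 :> K) = (m == 0).
Proof.
by rewrite -in_alg_int -[X in X == _]/(in_alg K _) fmorph_eq0 intr_eq0.
Qed.

Lemma field_intr_inj : injective (intmul (1 : K)).
Proof.
by move=> m n /eqP; rewrite -subr_eq0 -intrB field_intr_eq0 subr_eq0 => /eqP.
Qed.

(** An algebraic integer of Q, transported to the algebraic numbers, is a rational
    integer. *)
Lemma rational_integer x : x \in 1%VS -> O x -> exists m : int, x = m%:~R.
Proof.
case/vlineP=> r -> [P monP rootP].
have rootQ : root (map_poly intr P : {poly rat}) r.
  rewrite -(fmorph_root (in_alg K)).
  rewrite (_ : map_poly _ (map_poly intr P) = map_poly intr P) //.
  rewrite -map_poly_comp; apply: eq_map_poly => n.
  exact: (rmorph_int (in_alg K)).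
have rootC : root (map_poly intr P : {poly algC}) (ratr r).
  rewrite (_ : map_poly intr P = map_poly ratr (map_poly intr P : {poly rat})).
    by rewrite fmorph_root.
  rewrite -map_poly_comp; apply: eq_map_poly => n.
  exact/esym/(rmorph_int ratr).
have : (ratr r : algC) \in Num.int.
  apply: Cint_rat_Aint; first exact: Crat_rat.
  apply: root_monic_Aint rootC _ _; first by rewrite monic_map.
  by apply/polyOverP => i; rewrite coef_map /= intr_int.
case/intrP => m; rewrite -(ratr_int algC) => /fmorph_inj ->; exists m.
exact: in_alg_int.
Qed.

Lemma int_dvd_integer (N m : int) y : O y -> N%:~R * y = m%:~R -> (N %| m)%Z.
Proof.
move=> Oy e; have [N0|N0] := eqVneq N 0.
  by rewrite N0 mul0r in e; rewrite N0 dvd0z -field_intr_eq0 -e eqxx.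
have yE : y = (m%:~R / N%:~R : rat)%:A.
  apply: (@mulfI _ N%:~R); first by rewrite field_intr_eq0.
  have := rmorphM (in_alg K) N%:~R (m%:~R / N%:~R).
  by rewrite mulrC divfK ?intr_eq0 //= !in_alg_int e.
have [k yk] : exists k : int, y = k%:~R.
  by apply: rational_integer => //; rewrite yE memvZ // mem1v.
apply/dvdzP; exists k; apply: field_intr_inj.
by rewrite mulrC intrM -yk e.
Qed.

Definition multiple (N : nat) x := exists2 b, O b & x = N%:R * b.

Lemma multiple0 N : multiple N 0.
Proof. by exists 0; [apply: integer0 | rewrite mulr0]. Qed.

Lemma multipleD N x y : multiple N x -> multiple N y -> multiple N (x + y).
Proof.
move=> [a Oa ->] [b Ob ->].
by exists (a + b); [apply: integerD | rewrite mulrDr].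
Qed.

Lemma multipleMl N a x : O a -> multiple N x -> multiple N (a * x).
Proof.
move=> Oa [b Ob ->].
by exists (a * b); [apply: integerM | rewrite mulrCA].
Qed.

Lemma multipleMr N a x : O a -> multiple N x -> multiple N (x * a).
Proof. by rewrite mulrC; apply: multipleMl. Qed.

Lemma multipleN N x : multiple N x -> multiple N (- x).
Proof. by rewrite -mulN1r; apply: multipleMl; apply/integerN/integer1. Qed.

Lemma multiple_int N (m : int) : multiple N m%:~R -> (N %| m)%Z.
Proof. by move=> [b Ob e]; apply: (@int_dvd_integer N m b). Qed.

(** A monic equation of a reduces each power to a combination of boundedly many
    powers with integer coefficients, and modulo N there are finitely many of
    those. *)
Lemma powers_cong N a : (0 < N)%N -> O a ->
  exists i, exists2 r, (0 < r)%N & multiple N (a ^+ i - a ^+ (i + r)).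
Proof.
move=> N0 [P monP rootP]; set d := size P.
have Oa : O a by exists P.
pose R i := Pdiv.CommonRing.rmodp 'X^i P.
have powE i : a ^+ i = \sum_(k < d) ((R i)`_k)%:~R * a ^+ k.
  have szR : (size (R i) <= d)%N.
    by apply/ltnW/Pdiv.Ring.ltn_rmodpN0/monic_neq0.
  have := congr1 (fun p => (map_poly intr p : {poly K}).[a])
    (Pdiv.RingMonic.rdivp_eq monP 'X^i).
  rewrite rmorphD rmorphM /= map_polyXn !hornerE (eqP rootP) mulr0 add0r => ->.
  rewrite (horner_coef_wide _ (n := d)); last by rewrite (leq_trans (size_poly _ _)).
  by apply: eq_bigr => k _; rewrite coef_map.
pose f i : {ffun 'I_d -> 'I_N.-1.+1} := [ffun k : 'I_d => inord `|((R i)`_k %% N)%Z|%N].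
have fE i j : f i = f j -> multiple N (a ^+ i - a ^+ j).
  move=> /ffunP eij.
  have dvd k : exists c : int, (k < d)%N -> (R i)`_k - (R j)`_k = c * N.
    have [kd|] := ltnP k d; last by exists 0.
    have := eij (Ordinal kd); rewrite !ffunE /= => /(congr1 val).
    have lt c : (`|(c %% N)%Z| < N.-1.+1)%N.
      have := ltz_mod c (_ : (N : int) != 0); have := modz_ge0 c (_ : (N : int) != 0).
      by lia.
    rewrite /= !inordK // => e.
    have : ((R i)`_k == (R j)`_k %[mod N])%Z.
      have := modz_ge0 ((R i)`_k) (_ : (N : int) != 0).
      have := modz_ge0 ((R j)`_k) (_ : (N : int) != 0).
      by lia.
    by rewrite eqz_mod_dvd => /dvdzP[c ec]; exists c.
  have [c cE] := choice dvd.
  exists (\sum_(k < d) (c k)%:~R * a ^+ k).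
    by apply: integer_sum => k _; apply: integerM; [apply: integer_int | apply: integerX].
  rewrite !powE -sumrB mulr_sumr; apply: eq_bigr => k _.
  by rewrite -mulrBl -intrB cE // intrM mulrCA mulrA.
pose M := #|{ffun 'I_d -> 'I_N.-1.+1}|.
have /injectivePn[i [j ij]] : ~~ injectiveb (fun i : 'I_M.+1 => f i).
  apply/negP => /injectiveP /leq_card; rewrite card_ord.
  by rewrite ltnn.
move=> /fE cij; have {ij} : (i < j)%N || (j < i)%N by rewrite -neq_ltn.
case/orP=> lt; [exists i, (j - i)%N | exists j, (i - j)%N].
- by rewrite subn_gt0.
- by rewrite subnKC // ltnW.
- by rewrite subn_gt0.
- by rewrite subnKC ?(ltnW lt) //; rewrite -opprB; apply: multipleN.
Qed.

(** Beyond the preperiod, exponents may be shifted by multiples of the period; a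
    multiple j of the period beyond the preperiod may be shifted by itself. *)
Lemma power_idempotent N a : (0 < N)%N -> O a ->
  exists2 j, (0 < j)%N & multiple N (a ^+ j * a ^+ j - a ^+ j).
Proof.
move=> N0 Oa; have [i [r r0 cir]] := powers_cong N0 Oa.
have step m : (i <= m)%N -> forall k, multiple N (a ^+ m - a ^+ (m + k * r)).
  move=> im; elim=> [|k IH]; first by rewrite addn0 subrr; apply: multiple0.
  have -> : a ^+ m - a ^+ (m + k.+1 * r) = (a ^+ m - a ^+ (m + k * r)) +
      a ^+ (m + k * r - i) * (a ^+ i - a ^+ (i + r)).
    have e1 : (m + k * r = (m + k * r - i) + i)%N by lia.
    have -> : (m + k.+1 * r = (m + k * r - i) + (i + r))%N by lia.
    by rewrite mulrBr -!exprD -e1; ring.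
  by apply: multipleD => //; apply: multipleMl => //; apply: integerX.
exists (i.+1 * r)%N; first by rewrite muln_gt0.
rewrite -exprD -opprB; apply/multipleN/step.
by rewrite mulSn (leq_trans (leq_pmulr i r0)) // leq_addl.
Qed.
End Integers.

(** * Invertible ideals are locally principal *)

Ltac integral := repeat first
  [ assumption | exact: integer_nat | exact: integer_int | exact: integer1
  | exact: integer0 | apply: integerN | apply: integerB | apply: integerD
  | apply: integerX | apply: integerM ].

Section Ideals.
Variable K : fieldExtType rat.
Local Notation O := (@ringOfIntegers K).
Implicit Types (I J L : fracIdeal K) (x y a : K).

Lemma multiple_dvd m n x : (m %| n)%N -> multiple n x -> multiple m x.
Proof.
move=> /dvdnP[k ->] [b Ob ->]; exists (k%:R * b).
  by apply: integerM => //; apply: integer_nat.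
by rewrite natrM mulrA (mulrC m%:R).
Qed.

Lemma multiple_prod_sub n (I : Type) (r : seq I) (F G : I -> K) :
  (forall i, O (F i)) -> (forall i, O (G i)) -> (forall i, multiple n (F i - G i)) ->
  multiple n (\prod_(i <- r) F i - \prod_(i <- r) G i).
Proof.
move=> OF OG FG; elim: r => [|i r IH]; first by rewrite !big_nil subrr; apply: multiple0.
rewrite !big_cons.
have -> : F i * \prod_(j <- r) F j - G i * \prod_(j <- r) G j =
  F i * (\prod_(j <- r) F j - \prod_(j <- r) G j) + \prod_(j <- r) G j * (F i - G i) by ring.
by apply: multipleD; apply: multipleMl => //; apply: integer_prod.
Qed.

Definition nilpotent_mod N x := O x /\ exists k, multiple N (x ^+ k).

Lemma nilpotent_modD N x y :
  nilpotent_mod N x -> nilpotent_mod N y -> nilpotent_mod N (x + y).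
Proof.
move=> [Ox [k nx]] [Oy [l ny]]; split; first exact: integerD.
exists (k + l)%N; rewrite exprDn.
apply: big_ind => [||i _]; [exact: multiple0 | exact: multipleD |].
rewrite -mulr_natr; apply: multipleMr; first exact: integer_nat.
have [li|il] := leqP l i.
  rewrite -(subnK li) (exprD _ (i - l)); apply: multipleMl; first exact: integerX.
  by apply: multipleMl => //; apply: integerX.
have -> : (k + l - i = (l - i) + k)%N by lia.
rewrite exprD; apply: multipleMr; first exact: integerX.
by apply: multipleMl => //; apply: integerX.
Qed.

Lemma idempotent_modX N g k : O g -> multiple N (g * g - g) ->
  multiple N (g ^+ k.+1 - g).
Proof.
move=> Og gg; elim: k => [|k IH]; first by rewrite subrr; apply: multiple0.
have -> : g ^+ k.+2 - g = g * (g ^+ k.+1 - g) + (g * g - g) by rewrite exprS; ring.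
by apply: multipleD => //; apply: multipleMl.
Qed.

Lemma fracIdealB I x y : fi_set I x -> fi_set I y -> fi_set I (x - y).
Proof.
have [_ ID IM _ _] := fi_setP I => Ix Iy; apply: ID => //.
by rewrite -mulN1r; apply: IM => //; apply/integerN/integer1.
Qed.

(** Write 1 as a sum of products y_i z_i, with y_i in A and z_i in B.  Modulo N,
    each y_i z_i is a unit on one factor of the ring, cut out by an idempotent
    power, and nilpotent on the complement.  Patching the pairs (y_i, z_i) along
    orthogonal idempotents gives a product x w equal to an idempotent e, and
    1 - e vanishes because it is a sum of nilpotent elements. *)
Lemma local_generator (A B : fracIdeal K) N : (0 < N)%N ->
  mulset A B = O ->
  exists2 x, fi_set A x & exists2 w, fi_set B w & multiple N (1 - x * w).
Proof.
move=> N0 AB.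
have [A0 AD AM _ _] := fi_setP A; have [B0 BD BM _ _] := fi_setP B.
have OAB a b : fi_set A a -> fi_set B b -> O (a * b).
  by move=> Aa Bb; rewrite -AB; apply: mulset_mul.
have claim (s : seq (K * K)) : (forall u, u \in s -> fi_set A u.1 /\ fi_set B u.2) ->
    exists e x w, [/\ O e, fi_set A x, fi_set B w, multiple N (e * e - e) &
      multiple N (x * w - e)] /\
      forall u, u \in s -> nilpotent_mod N ((1 - e) * (u.1 * u.2)).
  elim: s => [|[y z] s IH] sAB.
    exists 0, 0, 0; rewrite !mulr0 !subr0.
    by split=> //; split=> //; [apply: integer0 | apply: multiple0 | apply: multiple0].
  have [|e [x [w [[Oe Ax Bw ee xw] nils]]]] := IH.
    by move=> u us; apply: sAB; rewrite inE us orbT.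
  have [/= Ay Bz] := sAB (y, z) (mem_head _ _).
  have Oe1 : O (1 - e) by apply: integerB => //; apply: integer1.
  set b := (1 - e) * (y * z); have Ob : O b by apply: integerM => //; apply: OAB.
  have [[//|j] _ ff] := power_idempotent N0 Ob.
  set f := b ^+ j.+1 in ff.
  have Of : O f by apply: integerX.
  have Of1 : O (1 - f) by apply: integerB => //; apply: integer1.
  have Obj : O (b ^+ j) by apply: integerX.
  have ef : multiple N (e * f).
    have -> : e * f = (- (y * z * b ^+ j)) * (e * e - e) by rewrite /f exprS /b; ring.
    by apply: multipleMl => //; apply/integerN/integerM => //; apply: OAB.
  have Oxy a c : fi_set A a -> fi_set B c -> O (a * c) by apply: OAB.
  (* The new idempotent 1 - (1 - e)(1 - f) adds to e the part f of y z outside e. *)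
  exists (e + f - e * f), (e * x + f * y), (e * w + f * (b ^+ j * z)); split; first split.
  - by apply: integerB; [apply: integerD | apply: integerM].
  - by apply: AD; apply: AM.
  - by apply: (BD); apply: (BM) => //; apply: (BM).
  - have -> : (e + f - e * f) * (e + f - e * f) - (e + f - e * f) =
        (e * e - e) + (f * f - f) + (e * f + 3%:R - (e + f) *+ 2) * (e * f) by ring.
    apply: multipleD; first exact: multipleD.
    apply: multipleMl => //; rewrite mulr2n.
    by integral.
  - have -> : (e * x + f * y) * (e * w + f * (b ^+ j * z)) - (e + f - e * f) =
        e * e * (x * w - e) + (e + 1) * (e * e - e) + (f + 1) * (f * f - f) +
        ((x * z) * b ^+ j + y * w + f * ((y * z) * b ^+ j) + 1) * (e * f).
      by rewrite /f exprS /b; ring.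
    do 3?apply: multipleD; apply: multipleMl => //.
    1-3: by integral.
    have Oxz := Oxy _ _ Ax Bz; have Oyz := Oxy _ _ Ay Bz; have Oyw := Oxy _ _ Ay Bw.
    by integral.
  move=> u; rewrite inE => /predU1P[->|us].
    have -> : (1 - (e + f - e * f)) * (y * z) = (1 - f) * b by rewrite /b; ring.
    split; first exact: integerM.
    exists j.+1; rewrite exprMn exprSr -mulrA -/f.
    apply: multipleMl; first exact: integerX.
    have -> : (1 - f) * f = (-1) * (f * f - f) by ring.
    by apply: multipleMl => //; apply/integerN/integer1.
  have [Ou [k ku]] := nils u us.
  have -> : (1 - (e + f - e * f)) * (u.1 * u.2) = (1 - f) * ((1 - e) * (u.1 * u.2)) by ring.
  split; first exact: integerM.
  by exists k; rewrite exprMn; apply: multipleMl => //; apply: integerX.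
have [s sAB s1] : mulset A B 1 by rewrite AB; apply: integer1.
have [e [x [w [[Oe Ax Bw ee xw] nils]]]] := claim s sAB.
exists x => //; exists w => //.
have Oe1 : O (1 - e) by apply: integerB => //; apply: integer1.
have [_ [k nk]] : nilpotent_mod N (1 - e).
  have -> : 1 - e = \sum_(u <- s) (1 - e) * (u.1 * u.2) by rewrite -mulr_sumr -s1 mulr1.
  rewrite big_seq.
  apply: big_ind => [||u us]; [|exact: nilpotent_modD|exact: nils u us].
  by split; [apply: integer0 | exists 1; rewrite expr1; apply: multiple0].
have e1 : multiple N (1 - e).
  have -> : 1 - e = (1 - e) * (1 - e) ^+ k - ((1 - e) ^+ k.+1 - (1 - e)).
    by rewrite exprS; ring.
  apply: multipleD; first exact: multipleMl.
  rewrite -mulN1r; apply: multipleMl; first by apply/integerN/integer1.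
  apply: idempotent_modX => //.
  by have -> : (1 - e) * (1 - e) - (1 - e) = e * e - e by ring.
have -> : 1 - x * w = (1 - e) + (-1) * (x * w - e) by ring.
by apply: multipleD => //; apply: multipleMl => //; apply/integerN/integer1.
Qed.

End Ideals.

(** * Products and images of comaximal ideals *)

Section Comaximal.
Variable K : fieldExtType rat.
Local Notation O := (@ringOfIntegers K).
Implicit Types (I J L : fracIdeal K) (x y a : K).

Lemma mulFIA : associative (@mulFI K).
Proof. by move=> I J L; apply: fracIdeal_eq; apply: mulsetA. Qed.

Lemma mulFIC : commutative (@mulFI K).
Proof. by move=> I J; apply: fracIdeal_eq; apply: mulsetC. Qed.

Lemma mul1FI : left_id (unitFI K) (@mulFI K).
Proof.
move=> I; apply: fracIdeal_eq; have [I0 ID IM _ _] := fi_setP I.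
apply/funext=> x; apply/propext; split; first exact: mulset_min.
by move=> Ix; rewrite -[x]mul1r; apply: mulset_mul => //; apply: integer1.
Qed.

HB.instance Definition _ :=
  Monoid.isComLaw.Build (fracIdeal K) (unitFI K) (@mulFI K) mulFIA mulFIC mul1FI.

Lemma classOf_prod (T : Type) (r : seq T) (P : pred T) (L : T -> fracIdeal K) :
  classOf (\big[@mulFI K/unitFI K]_(i <- r | P i) L i) =
  \sum_(i <- r | P i) classOf (L i).
Proof. exact: (big_morph _ (@classOfM K) (erefl : classOf (unitFI K) = 0)). Qed.

Definition integral_ideal I := (fi_set I `<=` O)%classic.

(** Stated with a single element so that it also makes sense for sets, such as the
    multiples of an integer, that carry no fractional ideal structure. *)
Definition comaximal (X Y : set K) := exists2 x, X x & Y (1 - x).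

Lemma comaximalS (X X' Y Y' : set K) :
  (X `<=` X')%classic -> (Y `<=` Y')%classic -> comaximal X Y -> comaximal X' Y'.
Proof. by move=> sX sY [x /sX Xx /sY Yx]; exists x. Qed.

Lemma integral_mulFI I J : integral_ideal I -> integral_ideal J ->
  integral_ideal (mulFI I J).
Proof.
move=> sI sJ x; apply: mulset_min x => [|x y|x y /sI Ox /sJ Oy];
  by [apply: integer0|apply: integerD|apply: integerM].
Qed.

Lemma integral_prodFI (T : Type) (r : seq T) (P : pred T) (L : T -> fracIdeal K) :
  (forall i, P i -> integral_ideal (L i)) ->
  integral_ideal (\big[@mulFI K/unitFI K]_(i <- r | P i) L i).
Proof. by move=> sL; apply: big_ind => // I J; apply: integral_mulFI. Qed.

Lemma comaximalM I J L : integral_ideal J -> integral_ideal L ->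
  comaximal I J -> comaximal I L -> comaximal I (mulFI J L).
Proof.
move=> sJ sL [x Ix Jx] [y Iy Ly]; have [I0 ID IM _ _] := fi_setP I.
exists ((1 - y) * x + y).
  by apply: ID => //; apply: (IM) => //; apply: sL.
have -> : 1 - ((1 - y) * x + y) = (1 - x) * (1 - y) by ring.
exact: mulset_mul.
Qed.

Lemma comaximal_prod (T : Type) (r : seq T) (P : pred T) (L : T -> fracIdeal K) I :
  (forall i, P i -> integral_ideal (L i) /\ comaximal I (L i)) ->
  comaximal I (\big[@mulFI K/unitFI K]_(i <- r | P i) L i).
Proof.
move=> IL; pose Q J := integral_ideal J /\ comaximal I J.
suff [] : Q (\big[@mulFI K/unitFI K]_(i <- r | P i) L i) by [].
apply: (big_ind Q) => [|J J' [sJ IJ] [sJ' IJ']|i /IL//].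
  split=> //; exists 0; first by have [] := fi_setP I.
  by rewrite subr0; apply: integer1.
by split; [apply: integral_mulFI | apply: comaximalM].
Qed.

Lemma comaximal_natM J m n : comaximal J (multiple m) -> comaximal J (multiple n) ->
  comaximal J (multiple (m * n)).
Proof.
have [J0 JD JM _ _] := fi_setP J.
move=> [x Jx mx] [y Jy ny]; have [b Ob eb] := mx.
exists (x + (1 - x) * y).
  apply: JD => //; apply: JM => //; rewrite eb.
  by apply: integerM => //; apply: integer_nat.
have -> : 1 - (x + (1 - x) * y) = (1 - x) * (1 - y) by ring.
case: mx => c Oc ->; case: ny => d Od ->.
by exists (c * d); [apply: integerM | rewrite natrM mulrACA].
Qed.

Lemma comaximal_nat J n : (0 < n)%N ->
  (forall q, prime q -> (q %| n)%N -> comaximal J (multiple q)) ->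
  comaximal J (multiple n).
Proof.
elim/ltn_ind: n => n IH n0 qJ; have [n1|n1] := leqP n 1.
  exists 0; first by have [] := fi_setP J.
  exists 1; first exact: integer1.
  by rewrite subr0 (_ : n = 1%N) ?mul1r //; apply/eqP; rewrite eqn_leq n1.
have pr := pdiv_prime n1; have dv := pdiv_dvd n.
rewrite -(divnK dv); apply: comaximal_natM; last exact: qJ.
apply: IH => [||q pr_q qn]; last by apply: qJ => //; apply: dvdn_trans qn (dvdn_div dv).
  by rewrite ltn_Pdiv ?prime_gt1.
by rewrite divn_gt0 ?prime_gt0 // dvdn_leq.
Qed.

(** a = x a + a (1 - x) with x in I and 1 - x in J; over several ideals this is the
    inclusion of the intersection in the product. *)
Lemma mem_mulFI I J a : comaximal I J -> fi_set I a -> fi_set J a -> fi_set (mulFI I J) a.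
Proof.
case=> x Ix Jx Ia Ja.
have -> : a = x * a + a * (1 - x) by ring.
by apply: mulsetD; apply: mulset_mul.
Qed.

Lemma mem_prodFI (T : eqType) (s : seq T) (L : T -> fracIdeal K) a :
  uniq s -> O a ->
  {in s, forall i, integral_ideal (L i) /\ fi_set (L i) a} ->
  {in s &, forall i j, i != j -> comaximal (L i) (L j)} ->
  fi_set (\big[@mulFI K/unitFI K]_(i <- s) L i) a.
Proof.
elim: s => [|i s IH] /=; first by rewrite big_nil.
move=> /andP[i_s us] Oa sL cL; rewrite big_cons.
apply: mem_mulFI; last 2 first.
- by have [] := sL i (mem_head _ _).
- apply: IH => // [j js|j k js ks]; first by apply: sL; rewrite inE js orbT.
  by apply: cL; rewrite inE ?js ?ks orbT.
rewrite big_seq; apply: comaximal_prod => j js.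
split; first by have [] := sL j; rewrite ?inE ?js ?orbT.
by apply: cL; rewrite ?inE ?eqxx ?js ?orbT //; apply: contraNneq i_s => ->.
Qed.

(** A common denominator is an argument because each use has one at hand: the
    scaled set is integral, or all its products with some element are. *)
Lemma is_fracIdeal_scale x I : x != 0 ->
  (exists d, [/\ O d, d != 0 & forall y, scaleset x I y -> O (d * y)]) ->
  is_fracIdeal (scaleset x I).
Proof.
move=> x0 den; have [I0 ID IM [y Iy y0] _] := fi_setP I; split=> //.
- by exists 0; rewrite ?mulr0.
- by move=> _ _ [u Iu <-] [v Iv <-]; exists (u + v); rewrite ?mulrDr //; apply: ID.
- by move=> a _ Oa [u Iu <-]; exists (a * u); [apply: IM | rewrite mulrCA].
- by exists (x * y); [exists y | rewrite mulf_neq0].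
Qed.

Lemma image_mulFI f I J : imageFI f (mulFI I J) = mulFI (imageFI f I) (imageFI f J).
Proof.
apply: fracIdeal_eq; apply/funext => z; apply/propext; split.
  case=> w; move: z => _ /[swap] <-; move: w; apply: mulset_min.
  - by rewrite rmorph0; apply: mulset0.
  - by move=> x y ? ?; rewrite rmorphD; apply: mulsetD.
  by move=> x y Ix Jy; rewrite rmorphM; apply: mulset_mul; [exists x | exists y].
apply: mulset_min z => [|_ _ [x Ix <-] [y Iy <-]|_ _ [x Ix <-] [y Iy <-]].
- by exists 0; rewrite ?rmorph0 //; apply: mulset0.
- by exists (x + y); rewrite ?rmorphD //; apply: mulsetD.
- by exists (x * y); rewrite ?rmorphM //; apply: mulset_mul.
Qed.

Lemma image_integers (f : 'AEnd(K)) x : O x <-> (f @` O)%classic x.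
Proof.
split=> [Ox|[y Oy <-]]; last exact: integer_aut.
exists ((f^-1)%AF x); first exact: integer_aut.
by rewrite -[RHS](lker0_lfunVK (AEnd_lker0 f)).
Qed.

Lemma image_unitFI (f : 'AEnd(K)) : imageFI f (unitFI K) = unitFI K.
Proof.
apply: fracIdeal_eq; apply/funext => x; apply/propext.
by split=> /(image_integers f).
Qed.

Lemma classAutD f c d : classAut f (c + d) = classAut f c + classAut f d :> idealClass K.
Proof.
elim/classOf_ind: c => I; elim/classOf_ind: d => J.
by rewrite -classOfM !classAutE -classOfM image_mulFI.
Qed.

Lemma classAut0 f : classAut f 0 = 0 :> idealClass K.
Proof. by rewrite -[0]/(classOf (unitFI K)) classAutE image_unitFI. Qed.
End Comaximal.

(** * Norms, traces and Galois conjugates *)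

Section Galois.
Variable K : splittingFieldType rat.
Local Notation O := (@ringOfIntegers K).
Local Notation gT := (gal_of {:K}).
Implicit Types (I J L A B : fracIdeal K) (f g : gT).

Lemma gal_fixed y : (forall f, f y = y) -> y \in 1%VS.
Proof.
move=> fy; have gal1 : galois (1%AS : {subfield K}) {:K}.
  rewrite /galois subvf normalFieldf andbT /=; apply/separableP => x _.
  apply: pcharf0_separable => q; rewrite !inE; apply/negP => /andP[pr_q].
  by rewrite -[q%:R]/((Posz q)%:~R) field_intr_eq0 => /eqP[q0]; rewrite q0 in pr_q.
have/galois_fixedField <- := gal1.
by apply/fixedFieldP; rewrite ?memvf // => f _; apply: fy.
Qed.

Lemma gal_comp f g y : g (f y) = (f * g)%g y.
Proof. by rewrite galM ?memvf. Qed.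

Definition normK y := \prod_(f : gT) f y.
Definition traceK y := \sum_(f : gT) f y.

Lemma gal_prod_fixed (F : gT -> K) : (forall f g, g (F f) = F (f * g)%g) ->
  \prod_f F f \in 1%VS.
Proof.
move=> Fg; apply: gal_fixed => g; rewrite rmorph_prod [RHS](reindex_inj (mulIg g)).
by apply: eq_bigr => f _; apply: Fg.
Qed.

Lemma integer_gal f y : O y -> O (f y).
Proof. exact: integer_aut. Qed.

Lemma normK_int y : O y -> exists m : int, normK y = m%:~R.
Proof.
move=> Oy; apply: rational_integer.
  by apply: gal_prod_fixed => f g; apply: gal_comp.
by apply: integer_prod => f _; apply: integer_gal.
Qed.

Lemma traceK_int y : O y -> exists m : int, traceK y = m%:~R.
Proof.
move=> Oy; apply: rational_integer.
  apply: gal_fixed => g; rewrite rmorph_sum [RHS](reindex_inj (mulIg g)).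
  by apply: eq_bigr => f _; apply: gal_comp.
by apply: integer_sum => f _; apply: integer_gal.
Qed.

Lemma normK_cofactor y : O y -> exists2 b, O b & normK y = b * y.
Proof.
move=> Oy; exists (\prod_(f : gT | f != 1%g) f y).
  by apply: integer_prod => f _; apply: integer_gal.
by rewrite /normK (bigD1 1%g) //= gal_id mulrC.
Qed.

Lemma normK_eq0 y : (normK y == 0) = (y == 0).
Proof.
apply/idP/idP => [|/eqP->]; last by rewrite /normK (bigD1 1%g) //= rmorph0 mul0r.
by move/prodf_eq0 => [f _]; rewrite fmorph_eq0.
Qed.

Lemma normKM x y : normK (x * y) = normK x * normK y.
Proof. by rewrite /normK -big_split; apply: eq_bigr => f _; rewrite rmorphM. Qed.

Lemma normK_nat n : normK (n%:R : K) = n%:R ^+ #|{: gT}|.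
Proof.
rewrite /normK (eq_bigr (fun=> n%:R)) => [|f _]; last by rewrite rmorph_nat.
by rewrite prodr_const.
Qed.

Lemma fracIdeal_nat I : integral_ideal I -> exists2 n, (0 < n)%N & fi_set I n%:R.
Proof.
have [I0 ID IM [y Iy y0] _] := fi_setP I => sI; have Oy := sI _ Iy.
have [m em] := normK_int Oy; have [b Ob eb] := normK_cofactor Oy.
exists `|m|%N.
  by rewrite absz_gt0 -(field_intr_eq0 K) -em normK_eq0.
have -> : `|m|%N%:R = (sgz m)%:~R * m%:~R :> K by rewrite -intrM -abszEsg.
by apply: (IM); [apply: integer_int | rewrite -em eb; apply: IM].
Qed.

(** P is the product of the X + f(x) over the Galois group; its coefficients are
    integral and invariant, hence rational integers. *)
Lemma norm_poly x : O x -> exists2 P : {poly int}, P \is monic /\ size P = #|{: gT}|.+1 &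
  forall n : int, normK (x + n%:~R) = (P.[n])%:~R.
Proof.
move=> Ox; pose Q : {poly K} := \prod_(f : gT) ('X - (- f x)%:P).
have OQ : forall i, O Q`_i.
  apply: (big_ind (fun q : {poly K} => forall i, O q`_i)) => [j|q r Oq Or j|f _ j].
  - by rewrite coef1; apply: integer_nat.
  - by rewrite coefM; apply: integer_sum => k _; apply: integerM.
  rewrite coefB coefX coefC; apply: integerB; first exact: integer_nat.
  by case: ifP => _; [apply/integerN/integer_gal | apply: integer0].
have mapQ g : map_poly g Q = Q.
  rewrite rmorph_prod [RHS](reindex_inj (mulIg g)); apply: eq_bigr => f _.
  by rewrite rmorphB /= map_polyX map_polyC /= rmorphN; congr ('X - (- _)%:P); apply: gal_comp.
have Qfix i : Q`_i \in 1%VS.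
  by apply: gal_fixed => g; rewrite -coef_map /= mapQ.
have [c cE] := choice (fun i => rational_integer (Qfix i) (OQ i)).
have szQ : size Q = #|{: gT}|.+1 by rewrite /Q -big_enum size_prod_XsubC cardE.
have monQ : Q \is monic by apply: monic_prod_XsubC.
pose P : {poly int} := \poly_(i < #|{: gT}|.+1) c i.
have PQ : map_poly intr P = Q.
  apply/polyP => i; rewrite coef_map coef_poly /=; case: ltnP => [_|le]; first by rewrite cE.
  by rewrite nth_default // szQ.
have inj := @field_intr_inj K.
exists P => [|n].
  rewrite -szQ -PQ size_map_inj_poly //; split=> //.
  by apply/eqP/inj; rewrite -lead_coef_map_inj // PQ (eqP monQ).
have <- : Q.[n%:~R] = (P.[n])%:~R by rewrite -PQ horner_map.
rewrite /Q horner_prod; apply: eq_bigr => f _.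
by rewrite !hornerE opprK rmorphD rmorph_int addrC.
Qed.

Lemma multiple_gal n f x : multiple n x -> multiple n (f x).
Proof.
move=> [b Ob ->]; exists (f b); first exact: integer_gal.
by rewrite rmorphM /= rmorph_nat.
Qed.

Lemma comaximal_image f I J : comaximal I J -> comaximal (imageFI f I) (imageFI f J).
Proof.
case=> x Ix Jx; exists (f x); first by exists x.
by exists (1 - x); rewrite // rmorphB rmorph1.
Qed.

Lemma imageFI_comp f g I : imageFI g (imageFI f I) = imageFI (f * g)%g I.
Proof.
apply: fracIdeal_eq; apply/funext => x; apply/propext; split.
  by case=> _ [y Iy <-] <-; exists y => //=; rewrite -gal_comp.
by case=> y Iy <-; exists (f y); [exists y | rewrite gal_comp].
Qed.

Lemma imageFI_id I : imageFI (1%g : gT) I = I.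
Proof.
apply: fracIdeal_eq; apply/funext => x; apply/propext; split.
  by case=> y Iy <-; rewrite gal_id.
by move=> Ix; exists x; rewrite ?gal_id.
Qed.

Lemma integral_image f J : integral_ideal J -> integral_ideal (imageFI f J).
Proof. by move=> sJ _ [x /sJ Ox <-]; apply: integer_gal. Qed.

(** A way to say, without primes, that J is a product of primes of residue degree
    one, prime to p, among which no two are distinct conjugates: a prime of higher
    degree is fixed by some f != 1, which prevents J and f(J) from being
    comaximal.  The condition passes to larger integral ideals. *)
Definition split_ideal (p : nat) J := [/\ integral_ideal J,
  comaximal J (multiple p) & forall f : gT, f != 1%g -> comaximal J (imageFI f J)].
End Galois.

(** * Values of an integer polynomial prime to given primes *)

Section AvoidRoots.

Lemma intr_Fp_eq0 q (m : int) : prime q -> (m%:~R == 0 :> 'F_q) = (q %| m)%Z.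
Proof. by move=> pr_q; rewrite (dvdz_pcharf (pchar_Fp pr_q)). Qed.

Lemma exists_nonroot (P : {poly int}) q : prime q -> P \is monic ->
  (size P <= q)%N -> exists r : 'F_q, (map_poly intr P).[r] != 0.
Proof.
move=> pr_q monP szP; apply: contrapT => noroot.
have := @max_poly_roots _ (map_poly intr P : {poly 'F_q}) (enum 'F_q).
rewrite monic_neq0 ?monic_map // enum_uniq -cardE card_Fp //.
have -> : all (root (map_poly intr P : {poly 'F_q})) (enum 'F_q).
  by apply/allP => r _; apply/negPn/negP => r0; apply: noroot; exists r.
move=> /(_ isT isT isT); rewrite ltnNge => /negP; apply.
by rewrite (leq_trans (size_poly _ _)).
Qed.

(** The primes are treated one after the other.  Modulo a new prime q the integer n
    can be moved to any residue by multiples of N and of the earlier primes, and P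
    has fewer roots than F_q has elements. *)
Lemma avoid_roots (P : {poly int}) (N : nat) (s : seq nat) : P \is monic ->
  {in s, forall q, [/\ prime q, size P <= q & coprime q N]%N} ->
  exists2 n : nat, (N %| n)%N & {in s, forall q : nat, ~~ (q %| P.[n])%Z}.
Proof.
move=> monP; elim: s => [|q s IH] qs; first by exists 0%N.
have [|n Nn ns] := IH; first by move=> q' q's; apply: qs; rewrite inE q's orbT.
have [pr_q szq qN] := qs q (mem_head _ _).
have [q_s|q_s] := boolP (q \in s).
  by exists n => // q'; rewrite inE => /predU1P[->|]; apply: ns.
have [r r0] := exists_nonroot pr_q monP szq.
pose c := (N * \prod_(q' <- s) q')%N.
have c0 : (c%:R : 'F_q) != 0.
  rewrite -[_%:R]/((Posz c)%:~R) intr_Fp_eq0 // -[(_ %| _)%Z]/(q %| c)%N.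
  rewrite Euclid_dvdM // negb_or -prime_coprime // qN /=.
  rewrite Euclid_dvd_prod // big_has; apply/hasPn => q' q's.
  have q'i : q' \in q :: s by rewrite inE q's orbT.
  have [pr_q' _ _] := qs q' q'i; rewrite dvdn_prime2 //.
  by apply: contraNneq q_s => ->.
pose j : 'F_q := (r - n%:R) / c%:R.
exists (n + c * j)%N.
  by rewrite dvdn_add // -mulnA dvdn_mulr.
have evalE q' : prime q' -> (P.[(n + c * j)%N])%:~R = (map_poly intr P).[(n + c * j)%:R] :> 'F_q'.
  by move=> _; rewrite -[_%:R]/((Posz _)%:~R) horner_map.
move=> q'; rewrite inE => /predU1P[->|q's].
  rewrite -intr_Fp_eq0 // evalE // natrD natrM natr_Zp.
  by rewrite /j mulrC divfK // addrC subrK.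
have [|pr_q' _ _] := qs q'; first by rewrite inE q's orbT.
rewrite -intr_Fp_eq0 // evalE //.
have -> : (n + c * j)%:R = n%:R :> 'F_q'.
  rewrite natrD natrM /c (big_rem q') //= !natrM.
  have -> : q'%:R = 0 :> 'F_q' by apply: pchar_Fp_0.
  by rewrite mul0r mulr0 mul0r addr0.
by rewrite -[n%:R]/((Posz n)%:~R) horner_map /= intr_Fp_eq0 // ns.
Qed.
End AvoidRoots.

(** * Split ideals in every invertible class *)

Section Cyclotomic.
Variables (p : nat) (p_prime : prime p).
Variable K : splittingFieldType rat.
Local Notation O := (@ringOfIntegers K).
Local Notation gT := (gal_of {:K}).
Variable zeta : K.
Hypothesis zeta_prim : p.-primitive_root zeta.
Hypothesis K_gen : <<1; zeta>>%VS = fullv.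
Implicit Types (I J L A B : fracIdeal K) (f g : gT).

Lemma integer_zeta : O zeta.
Proof.
exists ('X^p - 1); first exact: monicXnsubC (prime_gt0 p_prime).
by rewrite rmorphB /= map_polyXn rmorph1 /root !hornerE (prim_expr_order zeta_prim) subrr.
Qed.

Let Oz := integer_zeta.

Lemma zeta_neq0 : zeta != 0.
Proof. by rewrite (prim_root_eq0 zeta_prim) -lt0n prime_gt0. Qed.

Lemma integer_zetaV : O zeta^-1.
Proof.
have -> : zeta^-1 = zeta ^+ p.-1; last exact: integerX.
apply: (mulfI zeta_neq0); rewrite divff ?zeta_neq0 // -exprS prednK ?prime_gt0 //.
exact/esym/prim_expr_order.
Qed.

Lemma gal_zeta_inj f : f zeta = zeta -> f = 1%g.
Proof.
move=> fz; apply/eqP/gal_eqP => y _; rewrite gal_id.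
have sub : (<<1; zeta>> <= fixedField [set f])%VS.
  apply/FadjoinP; split; first exact: sub1v.
  by apply/fixedFieldP; rewrite ?memvf // => g /set1P->.
have /fixedFieldP : y \in fixedField [set f] by apply: (subvP sub); rewrite K_gen memvf.
by rewrite memvf => /(_ isT); apply; rewrite set11.
Qed.

(** Since the powers of eta sum to zero, p is the sum of the 1 - eta^i, each of which
    is a multiple of 1 - eta. *)
Lemma sub1_root_dvd (eta : K) : eta ^+ p = 1 -> eta != 1 -> O eta ->
  exists2 b, O b & (1 - eta) * b = p%:R.
Proof.
move=> etap eta1 Oe; exists (\sum_(i < p) \sum_(l < i) eta ^+ l).
  by do 2?apply: integer_sum => ? _; apply: integerX.
rewrite mulr_sumr (eq_bigr (fun i : 'I_p => 1 - eta ^+ i)); last first.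
  by move=> i _; rewrite -opprB mulNr -subrX1 opprB.
rewrite sumrB sumr_const card_ord (_ : \sum_(i < p) eta ^+ i = 0) ?subr0 //.
apply/eqP; have : (eta - 1) * (\sum_(i < p) eta ^+ i) == 0 by rewrite -subrX1 etap subrr.
by rewrite mulf_eq0 subr_eq0 (negPf eta1).
Qed.

Lemma zeta_sub_gal_dvd f : f != 1%g -> exists2 b, O b & (zeta - f zeta) * b = p%:R.
Proof.
move=> f1; have zp := prim_expr_order zeta_prim.
have z0 := zeta_neq0; have Oz1 := integer_zetaV.
have [|||b Ob eb] := @sub1_root_dvd (f zeta / zeta).
- by rewrite expr_div_n zp -rmorphXn /= zp rmorph1 divr1.
- apply: contraNneq f1 => e; apply/eqP/gal_zeta_inj.
  by rewrite -[RHS]mul1r -e divfK.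
- by apply: integerM => //; apply: integer_gal; apply: integer_zeta.
exists (zeta^-1 * b); first exact: integerM.
by rewrite mulrA -eb; congr (_ * _); rewrite mulrBl divff.
Qed.

(** Modulo q the norm of x - f(x) is that of zeta - f(zeta), a divisor of a power of
    p. *)
Lemma norm_sub_gal_coprime x f q (m : int) : prime q -> q != p -> O x ->
  multiple q (x - zeta) -> f != 1%g -> normK (x - f x) = m%:~R -> ~~ (q %| m)%Z.
Proof.
move=> pr_q qp Ox qx f1 em; apply/negP => qm.
have [b Ob eb] := zeta_sub_gal_dvd f1.
have Oxf : O (x - f x) by apply: integerB => //; apply: integer_gal.
have Ozf : O (zeta - f zeta) by apply: integerB => //; apply: integer_gal.
have : multiple q (normK (x - f x) - normK (zeta - f zeta)).
  apply: multiple_prod_sub => g; try exact: integer_gal.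
  rewrite -rmorphB; apply: multiple_gal.
  have -> : x - f x - (zeta - f zeta) = (x - zeta) + - f (x - zeta).
    by rewrite rmorphB /=; ring.
  by apply: multipleD => //; apply/multipleN/multiple_gal.
have qm' : multiple q (m%:~R : K).
  case/dvdzP: qm => c ->; exists c%:~R; first exact: integer_int.
  by rewrite intrM mulrC.
rewrite em => qsub; have qz : multiple q (normK (zeta - f zeta)).
  have -> : normK (zeta - f zeta) = m%:~R + - (m%:~R - normK (zeta - f zeta)) by ring.
  by apply: multipleD => //; apply: multipleN.
have [c Oc ec] : exists2 c, O c & normK b = c.
  by exists (normK b) => //; apply: integer_prod => g _; apply: integer_gal.
have : multiple q (((p ^ #|{: gT}|)%N : int)%:~R : K).
  rewrite -[_%:~R]/((p ^ _)%:R) natrX -normK_nat -eb normKM ec.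
  by apply: multipleMr.
move/multiple_int; rewrite -[(_ %| _)%Z]/(q %| p ^ _)%N.
by rewrite Euclid_dvdX // dvdn_prime2 // (negPf qp).
Qed.

(** With al = x + n, the ideal J = al B is comaximal with every
    prime dividing D, hence with the norm of al - f(al), an element of J + f(J). *)
Lemma split_representative A B :
  (#|{: gT}| < p)%N -> integral_ideal A -> mulset A B = O ->
  exists2 J, split_ideal p J & classOf J = classOf B.
Proof.
move=> card_gal sA AB; have [N N0 AN] := fracIdeal_nat sA.
have [A0 AD AM _ _] := fi_setP A; have [B0 BD BM _ _] := fi_setP B.
have OAB a b : fi_set A a -> fi_set B b -> O (a * b).
  by move=> Aa Bb; rewrite -AB; apply: mulset_mul.
have B1 : fi_set B 1.
  have : mulset A B 1 by rewrite AB; apply: integer1.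
  by apply: mulset_min => // a b /sA Oa Bb; apply: BM.
have [x0 Ax0 [w Bw x0w]] := local_generator N0 AB.
have [q0 ltq0 pr_q0] := prime_above (maxn N p).
have /andP[Nq0 pq0] : (N < q0)%N && (p < q0)%N by rewrite -gtn_max.
(* M collects the primes up to q0 that do not divide N; the prime q0 is there to
   ensure that the norms of the x - f(x) are nonzero. *)
pose M := (q0`!`_(\pi(N)^'))%N.
have coMN : coprime (N * N) M.
  by rewrite coprimeMl andbb (@pnat_coprime \pi(N)) ?pnat_pi ?part_pnat.
have M_dvd q : prime q -> (q <= q0)%N -> ~~ (q %| N)%N -> (q %| M)%N.
  move=> pr_q qq0 qN; rewrite /M.
  rewrite -[X in (X %| _)%N](@part_pnat_id (\pi(N)^') q).
    by apply: partn_dvd; rewrite ?fact_gt0 // dvdn_fact // prime_gt0.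
  by rewrite pnatE // !inE /= mem_primes pr_q N0.
pose e := chinese (N * N) M 0 1.
have eN : (N * N %| e)%N by rewrite /dvdn /e chinese_modl // mod0n.
have eM : e = 1 %[mod M] by rewrite /e chinese_modr.
have Ox0 := sA _ Ax0.
pose x := x0 + (zeta - x0) * e%:R.
have eNA y : O y -> fi_set A (y * e%:R).
  move=> Oy; case/dvdnP: eN => c ->; rewrite !natrM mulrA mulrA.
  by apply: AM => //; integral.
have Ax : fi_set A x by apply: AD => //; apply: eNA; integral.
have Ox := sA _ Ax.
have xzM : multiple M (x - zeta).
  have -> : x - zeta = (x0 - zeta) * (1 - e%:R) by rewrite /x; ring.
  apply: multipleMl; first by integral.
  have eE := congr1 (fun k => k%:R : K) (divn_eq e M).
  have oneE := congr1 (fun k => k%:R : K) (divn_eq 1 M).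
  exists ((1 %/ M)%:R - (e %/ M)%:R); first by integral.
  by rewrite /= in eE oneE; rewrite eE -[X in X - _]/(1%:R) oneE eM !natrD !natrM; ring.
have [P [monP szP] normP] := norm_poly Ox.
have [m mE] := choice (fun f => normK_int (integerB Ox (integer_gal f Ox))).
have q_m q f : prime q -> (q <= q0)%N -> ~~ (q %| N)%N -> q != p -> f != 1%g ->
    ~~ (q %| m f)%Z.
  move=> pr_q qq0 qN qp f1.
  have qx : multiple q (x - zeta) by apply: multiple_dvd xzM; apply: M_dvd.
  exact: (norm_sub_gal_coprime pr_q qp Ox qx f1 (mE f)).
pose D := (p * \prod_(f : gT | f != 1%g) `|m f|)%N.
have m_neq0 f : f != 1%g -> m f != 0.
  move=> f1; have := q_m q0 f pr_q0 (leqnn _) _ _ f1.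
  rewrite gtnNdvd ?gtn_eqF // => /(_ isT isT); apply: contraNneq => ->.
  exact: dvdz0.
have D0 : (0 < D)%N.
  rewrite muln_gt0 prime_gt0 //=; apply: prodn_cond_gt0 => f f1.
  by rewrite absz_gt0; apply: m_neq0.
(* Where n has to be adjusted, q is at least p, so that P, of degree below p, has a
   nonroot modulo q. *)
have pD q : prime q -> (q %| D)%N -> ~~ (q %| N)%N -> (p <= q)%N.
  move=> pr_q; rewrite /D Euclid_dvdM // Euclid_dvd_prod // => /orP[|].
    by rewrite dvdn_prime2 // => /eqP->.
  rewrite big_has_cond => /hasP[f _ /andP[f1 qf]] qN; rewrite leqNgt.
  apply/negP => ltqp; have := q_m q f pr_q (ltnW (ltn_trans ltqp pq0)) qN _ f1.
  by rewrite ltn_eqF // => /(_ isT)/negP; apply.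
have [|n NNn nq] := @avoid_roots P (N * N) [seq q <- primes D | ~~ (q %| N)%N] monP.
  move=> q; rewrite mem_filter mem_primes => /and4P[qN pr_q _ qD]; split=> //.
    by rewrite szP (leq_trans card_gal) // pD.
  by rewrite coprimeMr andbb prime_coprime.
pose al := x + n%:R; pose S := scaleset al B.
have Aal : fi_set A al.
  apply: AD => //; case/dvdnP: NNn => c ->; rewrite mulnA natrM.
  by apply: AM => //; integral.
have Oal := sA _ Aal.
have Sq q : prime q -> (q %| D)%N -> comaximal S (multiple q).
  move=> pr_q qD; have [qN|qN] := boolP (q %| N)%N.
    exists (al * w); first by exists w.
    apply: multiple_dvd qN _.
    case/dvdnP: eN => c ec; case/dvdnP: NNn => d ed.
    have -> : 1 - al * w = (1 - x0 * w) +
        (- ((zeta - x0) * c%:R + d%:R)) * (N%:R * w) * N%:R.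
      by rewrite /al /x ec ed !natrM; ring.
    apply: multipleD => //; apply: multipleMl.
      apply: integerM; last exact: OAB.
      by integral.
    by exists 1; [apply: integer1 | rewrite mulr1].
  have := nq q; rewrite mem_filter mem_primes qN pr_q D0 qD => /(_ isT) qP.
  have [b Ob eb] := normK_cofactor Oal.
  have Sm : S (P.[n])%:~R.
    exists b; last by rewrite mulrC -eb -normP.
    by rewrite -[b]mulr1; apply: BM.
  have /coprimezP[[u u'] /= uu] : coprimez P.[n] q.
    rewrite coprimez_sym /coprimez -[gcdz _ _]/(Posz (gcdn q `|P.[n]|)).
    by rewrite -[_ == _]/(coprime _ _) prime_coprime.
  exists (u%:~R * (P.[n])%:~R).
    case: Sm => y By <-; exists (u%:~R * y); last by rewrite mulrCA.
    by apply: BM => //; apply: integer_int.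
  exists u'%:~R; first exact: integer_int.
  have e1 : u%:~R * (P.[n])%:~R + u'%:~R * q%:R = 1 :> K.
    by rewrite -[q%:R]/((Posz q)%:~R) -!intrM -intrD uu.
  by rewrite -[X in X - _]e1; ring.
have al0 : al != 0.
  apply/eqP => al0; have [|_ [y _ <-]] := Sq p p_prime; first exact: dvdn_mulr.
  rewrite al0 mul0r subr0 => /(@multiple_int _ p 1).
  by rewrite -[(_ %| _)%Z]/(p %| 1)%N dvdn1 => /eqP p1; have := p_prime; rewrite p1.
have sS : (S `<=` O)%classic by move=> _ [y By <-]; apply: OAB.
have frS : is_fracIdeal S.
  apply: is_fracIdeal_scale => //; exists 1.
  by split=> [|| y Sy]; [apply: integer1 | apply: oner_neq0 | rewrite mul1r; apply: sS].
exists (FracIdeal frS); last by apply/esym/classOfP; exists al.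
split=> //= [|f f1]; first by apply: Sq => //; apply: dvdn_mulr.
have Sal : S al by exists 1; rewrite ?mulr1.
have [s Ss] : comaximal S (multiple `|m f|).
  apply: (@comaximal_nat _ (FracIdeal frS)) => [|q pr_q qm].
    by rewrite absz_gt0; apply: m_neq0.
  apply: Sq => //; apply: dvdn_mull; rewrite (bigD1 f) //=; exact: dvdn_mulr.
case=> b Ob eb.
have Oxf : O (x - f x) by apply: integerB => //; apply: integer_gal.
have [c Oc ec] := normK_cofactor Oxf; rewrite mE in ec.
have mfE : `|m f|%N%:R = (sgz (m f))%:~R * (c * (al - f al)) :> K.
  have -> : al - f al = x - f x by rewrite /al rmorphD rmorph_nat; ring.
  by rewrite -ec -intrM -abszEsg.
pose k := b * (sgz (m f))%:~R * c; have Ok : O k by rewrite /k; integral.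
have [_ SD SM _ _] := frS; have [_ _ fSM _ _] := image_fracIdeal f (FracIdeal frS).
exists (s + k * al); first by apply: SD => //; apply: SM.
have -> : 1 - (s + k * al) = - k * f al.
  by rewrite opprD addrA eb mfE /k; ring.
by apply: fSM; [apply: integerN | exists al].
Qed.

(** * Split ideals are products of primes of degree one *)

(** Some E is 1 modulo J and lies in f(J) for all f != 1.  Then f(E) lies in J for
    f != 1, so y is congruent modulo J to the trace of E y. *)
Lemma split_residue J y : split_ideal p J -> O y ->
  exists m : int, fi_set J (y - m%:~R).
Proof.
case=> sJ _ cJ Oy; have [J0 JD JM _ _] := fi_setP J.
have JN z : fi_set J z -> fi_set J (- z).
  by rewrite -mulN1r; apply: JM; apply/integerN/integer1.
have ex f : exists e, [/\ O e, fi_set J (1 - e) & f != 1%g -> fi_set (imageFI f J) e].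
  have [->|/cJ[z Jz fz]] := eqVneq f 1%g.
    by exists 1; rewrite subrr; split=> //; apply: integer1.
  exists (1 - z); rewrite subKr; split=> //.
  by apply: integerB; [apply: integer1 | apply: sJ].
have [e eP] := choice ex; pose E := \prod_(f : gT | f != 1%g) e f.
have [OE JE] : O E /\ fi_set J (1 - E).
  apply: (big_ind (fun z => O z /\ fi_set J (1 - z))).
  - by rewrite subrr; split=> //; apply: integer1.
  - move=> z w [Oz' Jz] [Ow Jw]; split; first exact: integerM.
    have -> : 1 - z * w = (1 - z) + z * (1 - w) by ring.
    by apply: JD => //; apply: JM.
  - by move=> f _; have [] := eP f.
have fE f : f != 1%g -> fi_set J (f E).
  move=> f1; have f1' : (f^-1)%g != 1%g by rewrite invg_eq1.
  have [_ _ /(_ f1') [z Jz ez]] := eP (f^-1)%g.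
  rewrite /E (bigD1 (f^-1)%g) //= -ez rmorphM /= gal_comp mulVg gal_id mulrC.
  apply: JM => //; apply: integer_gal; apply: integer_prod => g _.
  by have [] := eP g.
have [m em] := traceK_int (integerM OE Oy).
exists m; rewrite -em /traceK (bigD1 1%g) //= gal_id opprD addrA.
have -> : y - E * y = y * (1 - E) by ring.
apply: (JD); first exact: JM.
apply: (JN); apply: big_ind => // f f1; rewrite rmorphM mulrC.
by apply: JM; [apply: integer_gal | apply: fE].
Qed.

Lemma split_conjugates_comaximal J : split_ideal p J ->
  forall f g, f != g -> comaximal (imageFI f J) (imageFI g J).
Proof.
case=> _ _ cJ f g fg; rewrite -[g](mulgKV f) -imageFI_comp.
by apply/comaximal_image/cJ; rewrite -eq_mulgV1 eq_sym.
Qed.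

Definition residue_set (l : nat) (t : int) : set K :=
  [set x | exists a b, [/\ O a, O b & x = l%:R * a + (zeta - t%:~R) * b]]%classic.

Fact residue_fracIdeal l t : (0 < l)%N -> is_fracIdeal (residue_set l t).
Proof.
move=> l0; split.
- by exists 0, 0; rewrite !mulr0 addr0; split=> //; apply: integer0.
- move=> _ _ [a [b [Oa Ob ->]]] [c [d [Oc Od ->]]]; exists (a + c), (b + d).
  by split; [apply: integerD | apply: integerD | ring].
- move=> z _ Oz' [a [b [Oa Ob ->]]]; exists (z * a), (z * b).
  by split; [apply: integerM | apply: integerM | ring].
- exists l%:R; last by rewrite -[_%:R]/((Posz l)%:~R) field_intr_eq0 -lt0n.
  exists 1, 0; rewrite mulr1 mulr0 addr0.
  by split=> //; [apply: integer1 | apply: integer0].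
exists 1; split; [exact: integer1 | exact: oner_neq0 |].
by move=> _ [a [b [Oa Ob ->]]]; integral.
Qed.

Definition residueFI l t (l0 : (0 < l)%N) := FracIdeal (residue_fracIdeal t l0).

(** The conditions under which (l, zeta - t) is a prime with residue field F_l: t
    has order p modulo l, as zeta has, and the ideal is proper, in the form that
    it contains no integers but the multiples of l. *)
Record linear_prime (l : nat) (t : int) : Prop := LinearPrime {
  lp_prime : prime l;
  lp_prim : p.-primitive_root (t%:~R : 'F_l);
  lp_int : forall m : int, residue_set l t m%:~R -> (l %| m)%Z }.

Section LinearPrime.
Variables (l : nat) (t : int) (lp : linear_prime l t).
Let l_prime := lp_prime lp.
Let l0 := prime_gt0 l_prime.
Let L := residueFI t l0.

Lemma residue_mem_prime : fi_set L l%:R.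
Proof.
by exists 1, 0; rewrite mulr1 mulr0 addr0; split=> //; [apply: integer1|apply: integer0].
Qed.

Lemma residue_mem_root : fi_set L (zeta - t%:~R).
Proof.
by exists 0, 1; rewrite mulr1 mulr0 add0r; split=> //; [apply: integer0|apply: integer1].
Qed.

Lemma integral_residue : integral_ideal L.
Proof. by move=> _ [a [b [Oa Ob ->]]]; integral. Qed.

Lemma linear_prime_neq : l != p.
Proof.
apply: contraTneq (prim_root_natf_neq0 (lp_prim lp)) => <-.
by rewrite pchar_Fp_0 // eqxx.
Qed.

Lemma prime_comaximal : exists u u' : int, u%:~R * l%:R + u'%:~R * p%:R = 1 :> K.
Proof.
have /coprimezP[[u u'] /= uu] : coprimez l p.
  by rewrite -[coprimez _ _]/(coprime l p) prime_coprime // dvdn_prime2 // linear_prime_neq.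
by exists u, u'; rewrite -[l%:R]/((Posz l)%:~R) -[p%:R]/((Posz p)%:~R) -!intrM -intrD uu.
Qed.

(** The sum of the ideal and its conjugate by f != 1 contains l and
    zeta - f(zeta), which divides p. *)
Lemma split_residueFI : split_ideal p L.
Proof.
have [L0 LD LM _ _] := fi_setP L; have [u [u' uu]] := prime_comaximal.
split; first exact: integral_residue.
  exists (u%:~R * l%:R).
    by apply: LM; [apply: integer_int | apply: residue_mem_prime].
  exists u'%:~R; first exact: integer_int.
  by rewrite -[X in X - _]uu; ring.
move=> f f1; have [b Ob eb] := zeta_sub_gal_dvd f1.
have [_ _ fLM _ _] := fi_setP (imageFI f L).
exists (u%:~R * l%:R + u'%:~R * b * (zeta - t%:~R)).
  apply: LD; apply: LM; [exact: integer_int | exact: residue_mem_prime | | exact: residue_mem_root].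
  by apply: integerM => //; apply: integer_int.
have -> : 1 - (u%:~R * l%:R + u'%:~R * b * (zeta - t%:~R)) =
    - (u'%:~R * b) * f (zeta - t%:~R).
  by rewrite rmorphB rmorph_int -[X in X - _]uu -eb; ring.
apply: fLM; last by exists (zeta - t%:~R) => //; apply: residue_mem_root.
by apply/integerN/integerM => //; apply: integer_int.
Qed.

(** Expanding a product of ideals (l, z_f), all terms but the product of the z_f are
    multiples of l. *)
Lemma prod_residue (P : pred gT) x :
  fi_set (\big[@mulFI K/unitFI K]_(f | P f) imageFI f L) x ->
  exists a b, [/\ O a, O b & x = l%:R * a + (\prod_(f | P f) f (zeta - t%:~R)) * b].
Proof.
pose Q I z := O z /\ forall x, fi_set I x -> exists a b, [/\ O a, O b & x = l%:R * a + z * b].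
suff [_ QP] : Q (\big[@mulFI K/unitFI K]_(f | P f) imageFI f L)
  (\prod_(f | P f) f (zeta - t%:~R)) by apply: QP.
apply: (big_ind2 Q) => [|I z J w [Oz' QI] [Ow QJ]|f _].
- split=> [|y Oy]; first exact: integer1.
  by exists 0, y; rewrite mulr0 add0r mul1r; split=> //; apply: integer0.
- split=> [|y]; first exact: integerM.
  apply: (@mulset_min _ I J (fun y => exists a b, [/\ O a, O b & y = l%:R * a + z * w * b])) y
    => [|y y' [a [b [Oa Ob ->]]] [c [d [Oc Od ->]]]|].
  + by exists 0, 0; rewrite !mulr0 addr0; split=> //; apply: integer0.
  + by exists (a + c), (b + d); split; [apply: integerD | apply: integerD | ring].
  move=> _ _ /QI[a [b [Oa Ob ->]]] /QJ[c [d [Oc Od ->]]].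
  exists (l%:R * a * c + a * w * d + z * b * c), (b * d).
  by split; [integral | integral | ring].
split=> [|_ [_ [a [b [Oa Ob ->]]] <-]].
  by apply: integer_gal; integral.
exists (f a), (f b); rewrite rmorphD !rmorphM rmorph_nat.
by split=> //; apply: integer_gal.
Qed.

Lemma mem_prod_conjugates (P : pred gT) a : O a ->
  (forall f, P f -> fi_set (imageFI f L) a) ->
  fi_set (\big[@mulFI K/unitFI K]_(f | P f) imageFI f L) a.
Proof.
move=> Oa aL; have -> : \big[@mulFI K/unitFI K]_(f | P f) imageFI f L =
    \big[@mulFI K/unitFI K]_(f <- enum P) imageFI f L by rewrite big_enum.
apply: mem_prodFI => [||f|f g _ _ fg]; rewrite ?enum_uniq //.
  rewrite mem_enum => /aL; split=> //; exact/integral_image/integral_residue.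
by apply: split_conjugates_comaximal => //; apply: split_residueFI.
Qed.

Lemma image_mem_prime f : fi_set (imageFI f L) l%:R.
Proof. by exists l%:R; [apply: residue_mem_prime | rewrite rmorph_nat]. Qed.

(** The inclusion in (l) comes from [prod_residue]: the product of the f(zeta - t) is
    a rational integer of L, hence a multiple of l.  The other one is coprimality. *)
Lemma prod_conjugates :
  fi_set (\big[@mulFI K/unitFI K]_(f : gT) imageFI f L) = scaleset l%:R O.
Proof.
apply/funext => x; apply/propext; split.
  case/prod_residue => a [b [Oa Ob ->]].
  have Ozt : O (zeta - t%:~R) by integral.
  have [m em] := normK_int Ozt; have [c Oc ec] := normK_cofactor Ozt.
  have : (l %| m)%Z.
    apply: (lp_int lp); rewrite -em ec; have [_ _ LM _ _] := fi_setP L.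
    by apply: LM => //; apply: residue_mem_root.
  case/dvdzP => k mk; exists (a + k%:~R * b); first by integral.
  by rewrite -/(normK _) em mk intrM -[(Posz l)%:~R]/(l%:R); ring.
case=> a Oa <-; rewrite mulrC.
have [_ _ PM _ _] := fi_setP (\big[@mulFI K/unitFI K]_(f : gT) imageFI f L).
apply: PM => //; apply: mem_prod_conjugates => [|f _]; first exact: integer_nat.
exact: image_mem_prime.
Qed.
End LinearPrime.

Section LeastInteger.
Variables (J : fracIdeal K) (n : nat).
Hypotheses (splitJ : split_ideal p J) (n0 : (0 < n)%N) (Jn : fi_set J n%:R).
Hypothesis n_min : forall k, (0 < k)%N -> fi_set J k%:R -> (n <= k)%N.

Lemma least_integer_dvd (m : int) : fi_set J m%:~R -> (n %| m)%Z.
Proof.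
move=> Jm; have [_ _ JM _ _] := fi_setP J.
have n0' : (n : int) != 0 by rewrite eqz_nat -lt0n.
apply/dvdz_mod0P; apply: contrapT => /eqP r0; have r_ge0 := modz_ge0 m n0'; have r_lt := ltz_mod m n0'.
have Jr : fi_set J (`|(m %% n)%Z|%N)%:R.
  rewrite -[_%:R]/((Posz _)%:~R) gez0_abs // /modz intrB intrM.
  by apply: fracIdealB => //; apply: JM => //; apply: integer_int.
have := n_min _ Jr; rewrite absz_gt0 r0 => /(_ isT).
by lia.
Qed.

(** Take t congruent to zeta modulo J.  That t has order p modulo l follows from
    1 - zeta dividing p and J being prime to p.  The inclusion holds because modulo
    both ideals every algebraic integer is congruent to a rational one. *)
Lemma split_linear_prime l : prime l -> (l %| n)%N ->
  exists t, linear_prime l t /\ (fi_set J `<=` residue_set l t)%classic.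
Proof.
move=> pr_l ln; have [J0 JD JM _ _] := fi_setP J; have [sJ cJp _] := splitJ.
have l_dvd (m : int) : fi_set J m%:~R -> (l %| m)%Z.
  by move/least_integer_dvd; apply: dvdz_trans.
have lp : l != p.
  have [x Jx [b Ob eb]] := cJp.
  have [k Jk] := split_residue splitJ Ob.
  apply/eqP => lp; have : fi_set J (1 - p%:Z * k)%:~R.
    have -> : (1 - p%:Z * k)%:~R = x + p%:R * (b - k%:~R) :> K.
      by rewrite intrB intrM mulrBr -eb -[p%:~R]/(p%:R); ring.
    by apply: JD => //; apply: JM => //; apply: integer_nat.
  move/l_dvd; rewrite lp rpredBr ?dvdz_mulr //.
  by rewrite -[(_ %| _)%Z]/(p %| 1)%N dvdn1 => /eqP p1; have := p_prime; rewrite p1.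
have [t Jt] := split_residue splitJ Oz.
exists t.
have residueZ (m : int) : residue_set l t m%:~R -> (l %| m)%Z.
  case=> a [b [Oa Ob e]]; have [k Jk] := split_residue splitJ Oa.
  have : fi_set J (m - l%:Z * k)%:~R.
    have -> : (m - l%:Z * k)%:~R = l%:R * (a - k%:~R) + b * (zeta - t%:~R) :> K.
      by rewrite intrB intrM e -[l%:~R]/(l%:R); ring.
    by apply: JD; apply: JM => //; apply: integer_nat.
  by move/l_dvd; rewrite rpredBr // dvdz_mulr.
have prim_t : p.-primitive_root (t%:~R : 'F_l).
  have tp : (t%:~R : 'F_l) ^+ p = 1.
    apply/eqP; rewrite eq_sym -subr_eq0 -[1]/(1%:~R) -rmorphXn -intrB intr_Fp_eq0 //=.
    apply: l_dvd; rewrite intrB rmorphXn /=.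
    rewrite -[X in X - _](prim_expr_order zeta_prim) subrXX mulrC; apply: JM => //.
    by apply: integer_sum => i _; apply: integerM; apply: integerX => //; apply: integer_int.
  have [m prim_m] := prim_order_exists (prime_gt0 p_prime) tp.
  case/primeP: p_prime => _ mp /mp/orP[]/eqP em; last by rewrite -em.
  have t1 : t%:~R = 1 :> 'F_l by have := prim_expr_order prim_m; rewrite em expr1.
  have z1 : zeta != 1.
    apply/eqP => z1; have := eq_prim_root_expr zeta_prim 1 0.
    by rewrite expr0 expr1 z1 eqxx eqn_mod_dvd // subn0 dvdn1 => /esym/eqP p1; have := p_prime; rewrite p1.
  have [b Ob eb] := sub1_root_dvd (prim_expr_order zeta_prim) z1 Oz.
  have [k Jk] := split_residue splitJ Ob.
  have : fi_set J (p%:Z - (1 - t) * k)%:~R.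
    have -> : (p%:Z - (1 - t) * k)%:~R =
        (1 - t%:~R) * (b - k%:~R) + (- b) * (zeta - t%:~R) :> K.
      by rewrite intrB intrM intrB -[p%:~R]/(p%:R) -eb; ring.
    by apply: JD; apply: JM => //; integral.
  move/l_dvd; rewrite -intr_Fp_eq0 // intrB intrM intrB t1 subrr mul0r subr0 intr_Fp_eq0 //.
  by rewrite -[(_ %| _)%Z]/(l %| p)%N dvdn_prime2 // (negPf lp).
have lp' : linear_prime l t by [].
split=> // y Jy; have Oy := sJ y Jy.
have [k Lk] := split_residue (split_residueFI lp') Oy.
have [_ LD LM _ _] := fi_setP (residueFI t (prime_gt0 (lp_prime lp'))).
have [a [b [Oa Ob e]]] := Lk; have [c Jc] := split_residue splitJ Oa.
have lk : (l %| k)%Z.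
  have : fi_set J (k + l%:Z * c)%:~R.
    have -> : (k + l%:Z * c)%:~R = y + (- b) * (zeta - t%:~R) + (- l%:R) * (a - c%:~R) :> K.
      have -> : y = l%:R * a + (zeta - t%:~R) * b + k%:~R by rewrite -e; ring.
      by rewrite intrD intrM -[l%:~R]/(l%:R); ring.
    by apply: (JD); [apply: (JD) => //|]; apply: (JM) => //; integral.
  by move/l_dvd; rewrite rpredDr // dvdz_mulr.
have -> : y = (y - k%:~R) + k%:~R by rewrite subrK.
apply: LD => //; case/dvdzP: lk => c' ->; rewrite intrM.
by apply: LM; [apply: integer_int | apply: residue_mem_prime].
Qed.
End LeastInteger.

(** The quotient is l^-1 J L', where L' is the product of the conjugates f(L), f != 1,
    since L L' = (l).  It contains n / l because n lies in J and in L', which are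
    comaximal. *)
Lemma split_quotient J l t (lp : linear_prime l t) n :
  split_ideal p J -> (fi_set J `<=` residue_set l t)%classic ->
  fi_set J n%:R -> (l %| n)%N ->
  exists J', [/\ split_ideal p J', fi_set J' (n %/ l)%:R &
    J = mulFI J' (residueFI t (prime_gt0 (lp_prime lp)))].
Proof.
move=> [sJ cJp cJ] JL Jn ln; have [J0 JD JM _ _] := fi_setP J.
set L := residueFI _ _.
pose L' := \big[@mulFI K/unitFI K]_(f : gT | f != 1%g) imageFI f L.
have LL' : mulset L L' = scaleset l%:R O.
  by rewrite -(prod_conjugates lp) (bigD1 1%g) // imageFI_id.
have lK0 : (l%:R : K) != 0.
  by rewrite -[_%:R]/((Posz l)%:~R) field_intr_eq0 -lt0n prime_gt0 ?(lp_prime lp).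
have sL : integral_ideal L by apply: integral_residue.
have sL' : integral_ideal L' by apply: integral_prodFI => f _; apply: integral_image.
pose S := scaleset l%:R^-1 (mulFI J L').
have sS : (S `<=` O)%classic.
  move=> _ [y yJL' <-]; have : mulset L L' y.
    apply: (@mulset_min _ J L' (mulset L L')) yJL' => [||a b /JL La L'b].
    - exact: mulset0.
    - exact: mulsetD.
    exact: mulset_mul.
  by rewrite LL' => -[a Oa <-]; rewrite mulKf.
have frS : is_fracIdeal S.
  apply: is_fracIdeal_scale; first by rewrite invr_eq0.
  exists 1; split=> [||y Sy]; [apply: integer1|apply: oner_neq0|].
  by rewrite mul1r; apply: sS.
have L'l : fi_set L' l%:R.
  apply: (mem_prod_conjugates (lp := lp)) => [|f _].
    exact: integer_nat.
  exact: (image_mem_prime lp).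
have JS : (fi_set J `<=` S)%classic.
  by move=> y Jy; exists (y * l%:R); [apply: mulset_mul | rewrite mulrC mulfK].
have cJL' : comaximal J L'.
  apply: comaximal_prod => f f1; split; first exact: integral_image.
  apply: comaximalS (cJ f f1) => // _ [y /JL Ly <-]; by exists y.
exists (FracIdeal frS); split.
- split=> // [|f f1]; first exact: comaximalS cJp.
  apply: comaximalS (cJ f f1) => // _ [y /JS Sy <-]; by exists y.
- exists n%:R; last by rewrite -{1}(divnK ln) natrM mulrC mulfK.
  apply: mem_mulFI => //; rewrite -(divnK ln) natrM.
  by have [_ _ LM _ _] := fi_setP L'; apply: LM => //; apply: integer_nat.
apply: fracIdeal_eq; rewrite /= mulset_scale -mulsetA (mulsetC L') LL'.
rewrite mulsetC mulset_scale scalesetA mulVf // scaleset1 mulsetC.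
have /(congr1 (@fi_set _)) := mul1FI J.
by rewrite mulFIC.
Qed.

Lemma split_ideal_ind (Q : idealClass K -> Prop) :
  Q 0 -> (forall c d, Q c -> Q d -> Q (c + d)) ->
  (forall l t (lp : linear_prime l t),
     Q (classOf (residueFI t (prime_gt0 (lp_prime lp))))) ->
  forall J, split_ideal p J -> Q (classOf J).
Proof.
move=> Q0 QD QL J splitJ; have [n n0 Jn] : exists2 n, (0 < n)%N & fi_set J n%:R.
  by have [sJ _ _] := splitJ; apply: fracIdeal_nat.
elim/ltn_ind: n J splitJ n0 Jn => n IH J splitJ n0 Jn.
have [J0 JD JM _ _] := fi_setP J; have [sJ _ _] := splitJ.
have [[k [k0 kn Jk]]|no_k] := pselect (exists k, [/\ (0 < k)%N, (k < n)%N & fi_set J k%:R]).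
  exact: IH kn J splitJ k0 Jk.
have n_min k : (0 < k)%N -> fi_set J k%:R -> (n <= k)%N.
  by move=> k0 Jk; rewrite leqNgt; apply/negP => kn; apply: no_k; exists k.
have [n1|n1] := leqP n 1.
  have n1' : n = 1%N by apply/eqP; rewrite eqn_leq n1.
  suff -> : J = unitFI K by [].
  apply: fracIdeal_eq; apply/funext => x; apply/propext; split; first exact: sJ.
  by move=> Ox; rewrite -[x]mulr1; apply: JM => //; rewrite n1' in Jn.
have pr_l := pdiv_prime n1; have ln := pdiv_dvd n.
have [t [lp JL]] := split_linear_prime splitJ n0 Jn n_min pr_l ln.
have [J' [splitJ' J'n ->]] := split_quotient lp splitJ JL Jn ln.
rewrite classOfM; apply: QD; last exact: QL.
apply: IH splitJ' _ J'n.
  by rewrite ltn_Pdiv ?prime_gt1.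
by rewrite divn_gt0 ?prime_gt0 // dvdn_leq.
Qed.

(** * The factorization of the Jacobi sum *)

Section Stickelberger.
Hypothesis p_odd : odd p.
Variables (l : nat) (t : int) (lp : linear_prime l t).
Let l_prime := lp_prime lp.
Let tb : 'F_l := t%:~R.
Let tb_prim : p.-primitive_root tb := lp_prim lp.
Let L := residueFI t (prime_gt0 l_prime).
Let k := (l.-1 %/ p)%N.

Lemma card_Fl : #|'F_l| = l. Proof. exact: card_Fp. Qed.

Lemma expFl (x : 'F_l) : x ^+ l = x.
Proof. by have := expf_card x; rewrite card_Fl. Qed.

Lemma p_dvd_l1 : (p %| l.-1)%N.
Proof.
rewrite (prim_order_dvd tb_prim) -(inj_eq (mulfI (x := tb) _)).
  by rewrite mulr1 -exprS prednK ?prime_gt0 // expFl.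
by rewrite (prim_root_eq0 tb_prim) -lt0n prime_gt0.
Qed.

Lemma kpE : (k * p)%N = l.-1. Proof. by rewrite divnK ?p_dvd_l1. Qed.

Lemma k_bounds : (0 < k)%N && (k < l.-1)%N.
Proof.
have l1 : (0 < l.-1)%N by have := prime_gt1 l_prime; case: (l) => [|[|]].
have k0 : (0 < k)%N by have := l1; rewrite -kpE muln_gt0 => /andP[].
by rewrite k0 -kpE ltn_Pmulr // prime_gt1.
Qed.

Lemma tb2_prim : p.-primitive_root (tb ^+ 2).
Proof. by rewrite prim_root_exp_coprime // coprime2n. Qed.

Lemma residue_index_ex (x : 'F_l) : exists i : nat, x != 0 -> x ^+ k = (tb ^+ 2) ^+ i.
Proof.
have [->|x0] := eqVneq x 0; first by exists 0%N.
have xk : (x ^+ k) ^+ p = 1.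
  apply: (mulfI x0); rewrite -exprM kpE mulr1 -exprS prednK ?prime_gt0 //.
  by rewrite expFl.
by have [i xi] := prim_rootP tb2_prim xk; exists i.
Qed.

(** The exponent is taken to the base t^2 rather than t, which turns the Jacobi sum
    of this character into a generator of the product indexed by even exponents. *)
Definition residue_index (x : 'F_l) : nat := sval (cid (residue_index_ex x)).

Lemma residue_indexP x : x != 0 -> x ^+ k = (tb ^+ 2) ^+ residue_index x.
Proof. by rewrite /residue_index; case: cid. Qed.

Definition residue_char (eta : K) (x : 'F_l) : K :=
  if x == 0 then 0 else eta ^+ residue_index x.

Section Character.
Variable eta : K.
Hypothesis etap : eta ^+ p = 1.

Lemma residue_index_cong i x : x != 0 -> x ^+ k = (tb ^+ 2) ^+ i ->
  eta ^+ residue_index x = eta ^+ i.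
Proof.
move=> x0; rewrite residue_indexP // => /eqP.
rewrite (eq_prim_root_expr tb2_prim) => /eqP e.
by rewrite -(expr_mod _ etap) e expr_mod.
Qed.

Lemma residue_char0 : residue_char eta 0 = 0.
Proof. by rewrite /residue_char eqxx. Qed.

Lemma residue_char1 : residue_char eta 1 = 1.
Proof.
rewrite /residue_char oner_eq0 (@residue_index_cong 0) ?oner_neq0 //.
by rewrite expr1n expr0.
Qed.

Lemma residue_charM : {morph residue_char eta : x y / x * y}.
Proof.
move=> x y; rewrite /residue_char mulf_eq0.
have [->|x0] := eqVneq x 0; first by rewrite /= mul0r.
have [->|y0] /= := eqVneq y 0; first by rewrite mulr0.
rewrite -exprD; apply: residue_index_cong; first by rewrite mulf_neq0.
by rewrite exprMn !residue_indexP // exprD.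
Qed.
End Character.

Lemma residue_charV eta x : eta ^+ p = 1 ->
  residue_char eta x^-1 = residue_char eta^-1 x.
Proof.
move=> etap; rewrite /residue_char invr_eq0; case: eqVneq => // x0.
have eta0 : eta != 0.
  apply: contra_eq_neq etap => ->.
  by rewrite expr0n gtn_eqF ?prime_gt0 // eq_sym oner_eq0.
apply: (mulIf (x := eta ^+ residue_index x)); first by rewrite expf_neq0.
rewrite exprVn mulVf ?expf_neq0 //.
have := residue_charM etap x^-1 x; rewrite mulVf // residue_char1 //.
by rewrite /residue_char invr_eq0 (negPf x0).
Qed.

(** As eta has odd order p, the square of the character is nontrivial with it. *)
Lemma residue_char_nontrivial eta : p.-primitive_root eta ->
  exists2 g, g != 0 & residue_char eta g != 1 /\ residue_char eta g ^+ 2 != 1.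
Proof.
move=> prim; have [|g g0 gk] := @exists_expf_neq1 'F_l k.
  by rewrite card_Fl k_bounds.
exists g => //; rewrite /residue_char (negPf g0) -exprM.
have pi : ~~ (p %| residue_index g)%N.
  apply: contra gk; rewrite residue_indexP // -(prim_order_dvd tb2_prim).
  by [].
by rewrite -!(prim_order_dvd prim) Euclid_dvdM // (negPf pi) dvdn_prime2 // orFb;
  split => //; apply: contraTneq p_odd => ->.
Qed.

Lemma jacobi_norm eta : p.-primitive_root eta ->
  jacobi_sum (residue_char eta) * jacobi_sum (residue_char eta^-1) = l%:R.
Proof.
move=> prim; have etap := prim_expr_order prim.
have [g g0 [g1 g2]] := residue_char_nontrivial prim.
rewrite -[in RHS]card_Fl -(@jacobi_sum_norm _ _ (residue_char eta)).
- congr (_ * _); apply: eq_bigr => x _; by rewrite -!residue_charV.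
- exact: residue_char0.
- exact: residue_char1.
- exact: residue_charM.
- exact: (sum_char_eq0 (residue_charM etap) g0 g1).
apply: (@sum_char_eq0 _ _ (fun x => residue_char eta x ^+ 2)) g0 g2.
by move=> x y; rewrite residue_charM // exprMn.
Qed.

Lemma integer_jacobi eta : O eta -> O (jacobi_sum (residue_char eta)).
Proof.
move=> Oe; apply: integer_sum => x _; rewrite /residue_char.
by apply: integerM; case: ifP => _; by [apply: integer0 | apply: integerX].
Qed.

(** The character is congruent to x |-> x^(k w / 2) modulo I, so the Jacobi sum is
    congruent to the sum of [sum_expf_beta], whose degree k w is less than
    k p = l - 1. *)
Lemma jacobi_mem I eta w : integral_ideal I -> O eta -> (0 < w < p)%N -> ~~ odd w ->
  fi_set I l%:R -> fi_set I (eta - t%:~R ^+ w) ->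
  fi_set I (jacobi_sum (residue_char eta)).
Proof.
move=> sI Oe /andP[w0 wp] w_even Il Ieta; have [I0 ID IM _ _] := fi_setP I.
pose r (x : 'F_l) : int := if x == 0 then 0 else (t ^+ w) ^+ residue_index x.
have char_r x : fi_set I (residue_char eta x - (r x)%:~R).
  rewrite /residue_char /r; case: ifP => _; first by rewrite subrr.
  rewrite !rmorphXn subrXX mulrC; apply: (IM) => //.
  by apply: integer_sum => i _; integral.
(* The value at 0 is correct because the exponent is positive. *)
have rF x : (r x)%:~R = x ^+ (k * w./2) :> 'F_l.
  rewrite /r; case: eqVneq => [->|x0].
    rewrite expr0n muln_eq0 gtn_eqF /=; last by case/andP: k_bounds.
    by rewrite gtn_eqF // half_gt0; move: w0 w_even; case: (w) => [|[|]].
  rewrite exprM residue_indexP // !rmorphXn -!exprM; congr (_ ^+ _).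
  by rewrite mulnCA mul2n halfK (negPf w_even) subn0 mulnC.
have : (l %| \sum_x r x * r (1 - x))%Z.
  rewrite -intr_Fp_eq0 // rmorph_sum /=.
  rewrite (eq_bigr (fun x => x ^+ (k * w./2) * (1 - x) ^+ (k * w./2))).
    rewrite sum_expf_beta // card_Fl -mulnDr -kpE ltn_mul2l.
    rewrite (andP k_bounds).1 addnn.
    by rewrite (halfK w) (negPf w_even) subn0.
  by move=> x _; rewrite intrM !rF.
case/dvdzP => c ec.
have -> : jacobi_sum (residue_char eta) =
    \sum_x (residue_char eta x * residue_char eta (1 - x) - (r x)%:~R * (r (1 - x))%:~R)
    + c%:~R * l%:R.
  rewrite sumrB -[c%:~R * _]/(c%:~R * (Posz l)%:~R) -intrM -ec rmorph_sum /=.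
  under [X in _ = _ - _ + X]eq_bigr do rewrite intrM.
  by rewrite subrK.
apply: (ID); last by apply: IM => //; apply: integer_int.
apply: big_ind => // x _.
set a := residue_char eta x; set b := residue_char eta (1 - x).
have -> : a * b - (r x)%:~R * (r (1 - x))%:~R =
  b * (a - (r x)%:~R) + (r x)%:~R * (b - (r (1 - x))%:~R) by ring.
apply: ID; apply: IM; try exact: char_r; last exact: integer_int.
by rewrite /b /residue_char; case: ifP => _; by [apply: integer0 | apply: integerX].
Qed.

Variable w : gT -> nat.
Hypothesis w_bounds : forall f, (0 < w f < p)%N.
Hypothesis w_exp : forall f, zeta = f zeta ^+ w f.

Lemma image_mem_root f (u : nat) : fi_set (imageFI f L) (f zeta ^+ u - t%:~R ^+ u).
Proof.
have [_ _ IM _ _] := fi_setP (imageFI f L).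
rewrite subrXX mulrC; apply: IM.
  apply: integer_sum => i _; apply: integerM; apply: integerX; last exact: integer_int.
  exact: integer_gal.
exists (zeta - t%:~R); first exact: residue_mem_root.
by rewrite rmorphB rmorph_int.
Qed.

Lemma jacobi_mem_even f : ~~ odd (w f) ->
  fi_set (imageFI f L) (jacobi_sum (residue_char zeta)).
Proof.
move=> we; apply: (jacobi_mem _ _ (w_bounds f)) => //.
- exact/integral_image/integral_residue.
- exact: (image_mem_prime lp).
by rewrite [X in X - _](w_exp f); apply: image_mem_root.
Qed.

(** The inverse of zeta is the power of f(zeta) with exponent p - w f, which is even. *)
Lemma jacobi_mem_odd f : odd (w f) ->
  fi_set (imageFI f L) (jacobi_sum (residue_char zeta^-1)).
Proof.
move=> wo; have /andP[w0 wp] := w_bounds f.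
have zV : zeta^-1 = f zeta ^+ (p - w f).
  apply: (mulfI zeta_neq0); rewrite divff ?zeta_neq0 // {1}(w_exp f) -exprD subnKC ?(ltnW wp) //.
  by rewrite -rmorphXn /= (prim_expr_order zeta_prim) rmorph1.
apply: (@jacobi_mem _ _ (p - w f)) => //.
- exact/integral_image/integral_residue.
- by rewrite zV; apply/integerX/integer_gal.
- by rewrite subn_gt0 wp ltn_subrL w0 prime_gt0.
- by rewrite oddB ?(ltnW wp) // p_odd wo.
- exact: (image_mem_prime lp).
by rewrite zV; apply: image_mem_root.
Qed.

(** The Jacobi sum g lies in the product A of the f(L) with even exponent, and g' in the
    product A' of the others.  From A A' = (l) = (g g') it follows that A g' is
    contained in (g) g', whence A = (g). *)
Lemma stickelberger_principal :
  \sum_(f : gT | ~~ odd (w f)) classOf (imageFI f L) = 0 :> idealClass K.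
Proof.
rewrite -classOf_prod; apply/classOf_eq0.
have OzV := integer_zetaV.
set g := jacobi_sum (residue_char zeta); set g' := jacobi_sum (residue_char zeta^-1).
have gg : g * g' = l%:R := jacobi_norm zeta_prim.
have gg0 : g * g' != 0.
  by rewrite gg -[_%:R]/((Posz l)%:~R) field_intr_eq0 -lt0n prime_gt0.
have [g0 g'0] : g != 0 /\ g' != 0 by move: gg0; rewrite mulf_eq0 negb_or => /andP.
have mem := mem_prod_conjugates (lp := lp).
exists g => //; apply/funext => x; apply/propext; split.
  move=> Ax; have : scaleset l%:R O (x * g').
    rewrite -(prod_conjugates lp).
    rewrite (bigID (fun f => ~~ odd (w f))); apply: mulset_mul => //.
    apply: mem => [|f]; first exact: integer_jacobi.
    by rewrite negbK => /jacobi_mem_odd.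
  case=> y Oy; rewrite -gg => e; exists y => //.
  by apply: (mulIf g'0); rewrite -e; ring.
case=> y Oy <-; rewrite mulrC.
have [_ _ IM _ _] := fi_setP (\big[@mulFI K/unitFI K]_(f | ~~ odd (w f)) imageFI f L).
apply: IM => //; apply: mem => [|f]; first exact: integer_jacobi.
exact: jacobi_mem_even.
Qed.
End Stickelberger.
End Cyclotomic.

(** * Classes of the non-p-part are invertible *)

Lemma nonp_part_opp (V : nmodType) p (c : V) : nonp_part p c -> exists d, c + d = 0.
Proof.
case=> s [x [_ xP ->]].
have opp h : exists y, h \in s -> x h + y = 0.
  have [hs|] := boolP (h \in s); last by exists 0.
  have [_ _ [S [[subS _] _] Sx]] := xP h hs.
  by have [y _ xy] := sgN subS Sx; exists y.
have [y xy] := choice opp; exists (\sum_(h <- s) y h).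
by rewrite -big_split big_seq big1 //= => h /xy.
Qed.

Section InverseIdeal.
Variable K : fieldExtType rat.
Local Notation O := (@ringOfIntegers K).

(** The ideal of the opposite class is scaled so as to become integral, and the ideal
    of c so that the product becomes the unit ideal. *)
Lemma inverse_ideal (c d : idealClass K) : c + d = 0 ->
  exists A B : fracIdeal K, [/\ integral_ideal A, mulset A B = O & classOf B = c].
Proof.
elim/classOf_ind: c => I; elim/classOf_ind: d => J.
rewrite -classOfM => /classOf_eq0[g g0 /= IJ].
have [J0 JD JM [y Jy y0] [d [Od d0 dJ]]] := fi_setP J.
have dg0 : d * g != 0 by rewrite mulf_neq0.
have sA : (scaleset d J `<=` O)%classic by move=> _ [z Jz <-]; apply: dJ.
have frA : is_fracIdeal (scaleset d J).
  apply: is_fracIdeal_scale => //; exists 1; rewrite oner_neq0.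
  by split=> [||z]; [apply: integer1 | | rewrite mul1r; apply: sA].
have frB : is_fracIdeal (scaleset (d * g)^-1 I).
  apply: is_fracIdeal_scale; first by rewrite invr_eq0.
  exists (d * y); split=> [||_ [z Iz <-]]; [exact: dJ | by rewrite mulf_neq0 |].
  have : mulset I J (z * y) by apply: mulset_mul.
  rewrite IJ => -[a Oa ea]; suff -> : d * y * ((d * g)^-1 * z) = a by [].
  by apply: (mulfI dg0); rewrite -[RHS]mulrA ea; field; rewrite ?d0 ?g0.
exists (FracIdeal frA), (FracIdeal frB); split=> //=.
  rewrite mulset_scale mulsetC mulset_scale IJ !scalesetA.
  by rewrite mulrAC mulfV // scaleset1.
by apply/esym/classOfP; exists (d * g)^-1; rewrite ?invr_eq0.
Qed.
End InverseIdeal.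

(** * The Galois group as the set of powers of sigma *)

Section GaloisExponents.
Variables (p : nat) (p_prime : prime p).
Variables (K : splittingFieldType rat) (zeta : K).
Hypothesis zeta_prim : p.-primitive_root zeta.
Hypothesis K_gen : <<1; zeta>>%VS = fullv.
Variables (v : int) (sigma : gal_of {:K}).
Hypothesis v_prim : p.-1.-primitive_root (v%:~R : 'F_p).
Hypothesis sigma_zeta : sigma zeta = zeta ^ v.
Let u : 'F_p := v%:~R.

Lemma zeta_expFp m : zeta ^+ m = zeta ^+ (m%:R : 'F_p).
Proof. by rewrite val_Fp_nat // (expr_mod _ (prim_expr_order zeta_prim)). Qed.

Lemma zeta_expFpM (a b : 'F_p) : (zeta ^+ a) ^+ b = zeta ^+ (a * b : 'F_p)%R.
Proof. by rewrite -exprM zeta_expFp natrM !natr_Zp. Qed.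

Lemma zeta_expz : zeta ^ v = zeta ^+ u.
Proof.
rewrite /u; case: v => n; first exact: zeta_expFp.
have z0 := zeta_neq0 p_prime zeta_prim.
rewrite NegzE; apply: (mulIf (x := zeta ^+ n.+1)); first by rewrite expf_neq0.
rewrite -exprnN mulVf ?expf_neq0 // -exprD zeta_expFp natrD natr_Zp rmorphN.
by rewrite addNr expr0.
Qed.

Lemma gal_zeta_eq (f g : gal_of {:K}) : f zeta = g zeta -> f = g.
Proof.
move=> fg; apply/eqP; rewrite eq_mulgV1; apply/eqP.
apply: (gal_zeta_inj K_gen).
by rewrite -gal_comp fg gal_comp mulgV gal_id.
Qed.

Lemma sigmaX_zeta i : (sigma ^+ i)%g zeta = zeta ^+ (u ^+ i)%R.
Proof.
elim: i => [|i IH].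
  by rewrite expg0 gal_id expr0 -[LHS]expr1 zeta_expFp.
rewrite expgSr -gal_comp IH rmorphXn /= sigma_zeta zeta_expz zeta_expFpM.
by rewrite exprS.
Qed.

Lemma u_neq0 : u != 0.
Proof. by rewrite (prim_root_eq0 v_prim) -lt0n -subn1 subn_gt0 prime_gt1. Qed.

(** This identifies the exponent of zeta over sigma^i zeta with v_{-i}. *)
Lemma sigmaX_vres i : zeta = (sigma ^+ i)%g zeta ^+ vres p v (- i%:Z).
Proof.
rewrite sigmaX_zeta /vres zeta_expFpM -exprnN mulfV ?expf_neq0 ?u_neq0 //.
Qed.

Lemma sigmaX_inj : injective (fun i : 'I_p.-1 => (sigma ^+ i)%g).
Proof.
move=> i j /= e; have := congr1 (fun f : gal_of {:K} => f zeta) e.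
rewrite !sigmaX_zeta => /eqP; rewrite (eq_prim_root_expr zeta_prim).
have lt (a : 'F_p) : (a < p)%N by rewrite -[X in (_ < X)%N](Fp_cast p_prime).
rewrite !modn_small ?lt // => /eqP/val_inj/eqP.
by rewrite (eq_prim_root_expr v_prim) !modn_small // => /eqP/val_inj.
Qed.

Lemma sigmaX_surj f : exists i : 'I_p.-1, f = (sigma ^+ i)%g.
Proof.
have fzp : f zeta ^+ p = 1 by rewrite -rmorphXn /= (prim_expr_order zeta_prim) rmorph1.
have [a fa] := prim_rootP zeta_prim fzp.
have a0 : (a%:R : 'F_p) != 0.
  rewrite -val_eqE /= val_Fp_nat // modn_small //; apply/eqP => a0.
  move: fa; rewrite a0 expr0 => /eqP; rewrite fmorph_eq1 -[zeta]expr1.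
  by rewrite -(prim_order_dvd zeta_prim) dvdn1 => /eqP p1; have := p_prime; rewrite p1.
have up : (a%:R : 'F_p) ^+ p.-1 = 1.
  apply: (mulfI a0); rewrite mulr1 -exprS prednK ?prime_gt0 //.
  by have := expf_card (a%:R : 'F_p); rewrite card_Fp.
have [i ai] := prim_rootP v_prim up; exists i; apply: gal_zeta_eq.
by rewrite fa (sigmaX_zeta i) (zeta_expFp a); congr (_ ^+ nat_of_ord _); apply: ai.
Qed.
End GaloisExponents.

Theorem theorem4p3 (p : nat) (p_prime : prime p) (p_odd : odd p)
    (K : splittingFieldType rat) (zeta : K)
    (zeta_prim : p.-primitive_root zeta)
    (K_gen : <<1; zeta>>%VS = fullv)
    (v : int) (v_prim : p.-1.-primitive_root (v%:~R : 'F_p))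
    (sigma : gal_of {:K}) (sigma_gen : generator 'Gal({:K} / 1) sigma)
    (sigma_zeta : sigma zeta = zeta ^ v)
    (c : idealClass K) (c_nonp : nonp_part p c) :
  PiAct p v sigma c = 0.
Proof.
have [k kP] := choice (sigmaX_surj p_prime zeta_prim K_gen v_prim sigma_zeta).
have sX_inj := sigmaX_inj p_prime zeta_prim v_prim sigma_zeta.
have sX_bij : bijective (fun i : 'I_p.-1 => (sigma ^+ i)%g).
  by exists k => [i|f]; [apply: sX_inj; rewrite -kP | rewrite -kP].
have card_gal : (#|{: gal_of {:K}}| < p)%N.
  by rewrite -(bij_eq_card sX_bij) card_ord prednK ?prime_gt0.
pose w (f : gal_of {:K}) := vres p v (- (k f)%:Z).
have w_exp (f : gal_of {:K}) : zeta = f zeta ^+ w f.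
  by have := sigmaX_vres p_prime zeta_prim v_prim sigma_zeta (k f); rewrite -kP.
have w_bounds f : (0 < w f < p)%N.
  have := vres_bounds (- (k f)%:Z) p_prime (u_neq0 p_prime v_prim).
  by case/andP=> w0 wp; rewrite w0 (leq_ltn_trans wp) // prednK ?prime_gt0.
have PiE d : PiAct p v sigma d = \sum_(f : gal_of {:K} | ~~ odd (w f)) classAut f d.
  rewrite /PiAct big_mkord (reindex _ (onW_bij _ sX_bij)); apply: eq_big => // i.
  by rewrite /w; congr (~~ odd (vres p v (- (nat_of_ord _)%:Z))); apply: sX_inj; rewrite -kP.
have [c' cc'] := nonp_part_opp c_nonp.
have [A [B [sA AB <-]]] := inverse_ideal cc'.
have [J splitJ <-] := split_representative p_prime zeta_prim K_gen card_gal sA AB.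
apply: (split_ideal_ind (p_prime := p_prime) (zeta_prim := zeta_prim) K_gen
  (Q := fun d => PiAct p v sigma d = 0) _ _ _ splitJ).
- by rewrite /PiAct big1 // => i _; apply: classAut0.
- move=> d e Pd Pe; rewrite -[RHS]addr0 -{1}Pd -Pe /PiAct -big_split /=.
  by apply: eq_bigr => i _; apply: classAutD.
move=> l t lp; rewrite PiE.
under eq_bigr do rewrite classAutE.
exact: stickelberger_principal.
Qed.
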